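(* Let $\alpha\in(1,2)$, let $b:\mathbb{R}^d\to\mathbb{R}^d$ be measurable with $\|b\|_\infty:=\sup_{x\in\mathbb{R}^d}|b(x)|<\infty$, and let $T>0$ be fixed. Then there exists a constant $C>0$ such that $$p^{(\delta)}(j\delta,x;t,y)\le C\,p_\alpha(t-j\delta,\,y-x)$$ for all $x,y\in\mathbb{R}^d$, all $\delta\in(0,1)$, all integers $j\ge 0$ and all $t$ with $j\delta<t\le T$.
   Context: Let $(W_t)_{t\ge0}$ be a standard $d$-dimensional Brownian motion and $(S_t)_{t\ge0}$ an $\alpha/2$-stable subordinator independent of $W$, i.e. a nonnegative increasing one-dimensional Lévy process with $\mathbb{E}\,\mathrm{e}^{-\gamma S_t}=\mathrm{e}^{-t\gamma^{\alpha/2}}$ for $\gamma,t\ge0$. Then $(W_{S_t})_{t\ge0}$ is a rotationally invariant $d$-dimensional $\alpha$-stable process. For $t>0$, $p_\alpha(t,\cdot)$ denotes the density of $W_{S_t}$; with $\eta_t$ the density of $S_t$, $p_\alpha(t,x)=\int_0^\infty(2\pi s)^{-d/2}\mathrm{e}^{-|x|^2/(2s)}\eta_t(s)\,\mathrm{d}s$. For $\delta\in(0,1)$, the Euler-Maruyama scheme is the process $X^{(\delta)}$ defined by $$\mathrm{d}X^{(\delta)}_t=b\big(X^{(\delta)}_{t_\delta}\big)\,\mathrm{d}t+\mathrm{d}W_{S_t},\qquad t\ge0,\qquad t_\delta:=\lfloor t/\delta\rfloor\delta,$$ where $\lfloor t/\delta\rfloor$ is the integer part of $t/\delta$. For $t>s$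 and $x\in\mathbb{R}^d$, $p^{(\delta)}(s,x;t,\cdot)$ denotes the transition density of $X^{(\delta)}_t$ with starting point $X^{(\delta)}_s=x$; here it is used for $s=j\delta$. *)

(* Defs.v *)
From HB Require Import structures.
From mathcomp Require Import all_boot all_order all_algebra.
From mathcomp Require Import all_classical all_reals all_analysis.
Set Implicit Arguments.
Unset Strict Implicit.
Unset Printing Implicit Defensive.
Import Order.TTheory GRing.Theory Num.Theory.
Import numFieldNormedType.Exports.
Local Open Scope classical_set_scope.
Local Open Scope ring_scope.

(* The Borel sigma-algebra of R^n, generated by the coordinates, in the same
   way as the library does for [n.-tuple T]. *)
Definition measure_rV_display : measure_display -> measure_display.
Proof. exact. Qed.

Section measurable_rV.
Context {d} {T : measurableType d}.
Variable n : nat.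

Let coors : 'I_n -> 'rV[T]_n -> T := fun i x => x ord0 i.

Let rV_set0 : g_sigma_preimage coors set0.
Proof. exact: sigma_algebra0. Qed.

Let rV_setC A : g_sigma_preimage coors A -> g_sigma_preimage coors (~` A).
Proof. exact: sigma_algebraC. Qed.

Let rV_bigcup (F : (set 'rV[T]_n)^nat) :
  (forall i, g_sigma_preimage coors (F i)) ->
  g_sigma_preimage coors (\bigcup_i (F i)).
Proof. exact: sigma_algebra_bigcup. Qed.

HB.instance Definition _ := @isMeasurable.Build (measure_rV_display d)
  'rV[T]_n (g_sigma_preimage coors) rV_set0 rV_setC rV_bigcup.

Lemma measurable_rV_coord (i : 'I_n) :
  measurable_fun [set: 'rV[T]_n] (fun x : 'rV[T]_n => x ord0 i).
Proof.
move=> _ Y mY; rewrite setTI; apply: sub_sigma_algebra => /=.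
rewrite -bigcup_seq/=; exists i => /=; first by rewrite mem_index_enum.
by exists Y => //; rewrite setTI.
Qed.

Lemma measurable_fun_rVP d1 (T1 : measurableType d1) (f : T1 -> 'rV[T]_n) :
  measurable_fun [set: T1] f <->
  forall i, measurable_fun [set: T1] (fun x => f x ord0 i).
Proof.
apply: (@iff_trans _ (g_sigma_preimage
    (fun i => (fun x : 'rV[T]_n => x ord0 i) \o f) `<=` measurable)).
  rewrite g_sigma_preimage_comp; split=> [mf A [/= C preC <-]|prefS].
    exact: mf.
  by move=> _ A mA; apply: prefS; exists A.
split=> [fS i|mf].
- move=> _ A mA; apply: fS; apply: sub_sigma_algebra.
  rewrite -bigcup_seq/=; exists i => /=; first by rewrite mem_index_enum.
  by exists A.
- apply: smallest_sub; first exact: sigma_algebra_measurable.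
  rewrite -bigcup_seq/=; apply: bigcup_sub => i _.
  by move=> A [B mB <-]; exact: mf.
Qed.

End measurable_rV.

Section lebesgue_measure_rV.
Context {R : realType}.

(* [lebesgue_measure] lives on [measurableTypeR R], hence the type of [z]. *)
Definition rV_cons (n : nat) (z : 'rV[R]_n * measurableTypeR R) : 'rV[R]_n.+1 :=
  \row_(i < n.+1) if unlift ord0 i is Some j then z.1 ord0 j else z.2.

Lemma measurable_rV_cons (n : nat) : measurable_fun setT (@rV_cons n).
Proof.
apply/measurable_fun_rVP => i.
rewrite (_ : (fun _ => _) = fun z : 'rV[R]_n * measurableTypeR R =>
    if unlift ord0 i is Some j then z.1 ord0 j else z.2 : R); last first.
  by apply/funext => z; rewrite mxE.
case: (unlift ord0 i) => [j|]; last exact: measurable_snd.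
exact: (measurableT_comp (measurable_rV_coord j) measurable_fst).
Qed.

Section step.
Variables (n : nat) (mu : {measure set 'rV[R]_n -> \bar R}).

Definition lebesgue_rV_step : set 'rV[R]_n.+1 -> \bar R :=
  pushforward (mu \x lebesgue_measure)%E (@rV_cons n).

HB.instance Definition _ := Measure.copy lebesgue_rV_step
  (measure_function_pushforward__canonical__measure_function_Measure
    (mu \x lebesgue_measure)%E (@measurable_rV_cons n)).

End step.

(* Lebesgue measure on R^n: the n-fold product of [lebesgue_measure]. *)
Fixpoint lebesgue_rV (n : nat) : {measure set 'rV[R]_n -> \bar R} :=
  match n with
  | 0 => \d_ (0 : 'rV[R]_0)
  | m.+1 => lebesgue_rV_step (lebesgue_rV m)
  end.

End lebesgue_measure_rV.

Section densities.
Context {R : realType}.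

Definition enorm (n : nat) (x : 'rV[R]_n) : R :=
  Num.sqrt (\sum_(i < n) x ord0 i ^+ 2).

Definition has_density (dO : measure_display) (Omega : measurableType dO)
    (P : probability Omega R) (dE : measure_display) (E : measurableType dE)
    (mu : set E -> \bar R) (Y : Omega -> E) (f : E -> R) : Prop :=
  [/\ measurable_fun setT f, (forall y, 0 <= f y) &
      forall A : set E, measurable A ->
        P (Y @^-1` A) = (\int[mu]_(y in A) (f y)%:E)%E].

(* Density of the centred Gaussian law on R^n with covariance matrix s.I_n. *)
Definition gauss_density (n : nat) (s : R) (x : 'rV[R]_n) : R :=
  (2 * pi * s) `^ (- (n%:R / 2)) * expR (- (enorm x ^+ 2 / (2 * s))).

(* [eta t] is meant to be a density of S_t; the value is in [\bar R] because it
   is the integral of a nonnegative function. *)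
Definition p_alpha (n : nat) (eta : R -> R -> R) (t : R) (x : 'rV[R]_n) :
    \bar R :=
  (\int[lebesgue_measure]_(s in `]0%R, +oo[)
     (gauss_density s x * eta t s)%:E)%E.

End densities.

Section processes.
Context {R : realType} {dO : measure_display} {Omega : measurableType dO}.
Variable P : probability Omega R.

Definition mutually_independent (dE : measure_display) (E : measurableType dE)
    (n : nat) (Y : 'I_n -> Omega -> E) : Prop :=
  forall B : 'I_n -> set E, (forall i, measurable (B i)) ->
    P (\big[setI/setT]_(i < n) (Y i @^-1` B i)) =
    (\prod_(i < n) P (Y i @^-1` B i))%E.

(* The sigma-algebra generated by the variables [X t], [0 <= t]. *)
Definition process_sigma (dE : measure_display) (E : measurableType dE)
    (X : R -> Omega -> E) : set (set Omega) :=
  <<s [set A | exists t B, [/\ 0 <= t, measurable B & A = X t @^-1` B]] >>.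

Definition independent_processes (dE dF : measure_display)
    (E : measurableType dE) (F : measurableType dF)
    (X : R -> Omega -> E) (Y : R -> Omega -> F) : Prop :=
  forall A B, process_sigma X A -> process_sigma Y B ->
    P (A `&` B) = (P A * P B)%E.

(* Processes are indexed by R, but only times [0 <= t] are ever constrained. *)
Definition brownian_motion (n : nat) (W : R -> {RV P >-> 'rV[R]_n}) : Prop :=
  [/\ {ae P, forall w, W 0 w = 0},
      forall (k : nat) (t : nat -> R), 0 <= t 0%N ->
        (forall i, t i <= t i.+1) ->
        mutually_independent
          (fun (i : 'I_k) w => W (t i.+1) w - W (t i) w),
      forall s t, 0 <= s -> s < t ->
        has_density P (lebesgue_rV n) (fun w => W t w - W s w)
          (gauss_density (t - s)) &
      {ae P, forall w,
         {within [set t | 0 <= t], continuous (fun t => W t w)}}].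

Definition levy_process (S : R -> {RV P >-> R}) : Prop :=
  [/\ {ae P, forall w, S 0 w = 0},
      forall (k : nat) (t : nat -> R), 0 <= t 0%N ->
        (forall i, t i <= t i.+1) ->
        mutually_independent
          (fun (i : 'I_k) w => S (t i.+1) w - S (t i) w),
      forall s t, 0 <= s -> 0 <= t -> forall B : set R, measurable B ->
        P ((fun w => S (s + t) w - S s w) @^-1` B) = P (S t @^-1` B) &
      {ae P, forall w,
         (forall t, 0 <= t -> (fun u => S u w) @ t^'+ --> S t w) /\
         (forall t, 0 < t -> cvg ((fun u => S u w) @ t^'-))}].

Definition stable_subordinator (beta : R) (S : R -> {RV P >-> R}) : Prop :=
  [/\ levy_process S,
      {ae P, forall w, forall t, 0 <= t -> 0 <= S t w},
      {ae P, forall w, forall s t, 0 <= s -> s <= t -> S s w <= S t w} &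
      forall gamma t, 0 <= gamma -> 0 <= t ->
        ('E_P[fun w => expR (- (gamma * S t w))] =
         (expR (- (t * gamma `^ beta)))%:E)%E].

Definition grid_floor (delta t : R) : R := (Num.floor (t / delta))%:~R * delta.

(* [X] solves dX_t = b(X_(t_delta)) dt + dW_(S_t) on [s, +oo[ with X_s = x;
   the drift integral is taken coordinatewise. *)
Definition euler_maruyama (n : nat) (b : 'rV[R]_n -> 'rV[R]_n)
    (W : R -> {RV P >-> 'rV[R]_n}) (S : R -> {RV P >-> R})
    (delta s : R) (x : 'rV[R]_n) (X : R -> {RV P >-> 'rV[R]_n}) : Prop :=
  {ae P, forall w, forall t, s <= t ->
     X t w = x
       + \row_(i < n) \int[lebesgue_measure]_(u in `[s, t])
            (b (X (grid_floor delta u) w) ord0 i)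
       + (W (S t w) w - W (S s w) w)}.

(* Densities are only determined up to Lebesgue-null sets; the transition
   density is the continuous version, which is unique. *)
Definition is_transition_density (n : nat) (Y : {RV P >-> 'rV[R]_n})
    (p : 'rV[R]_n -> R) : Prop :=
  has_density P (lebesgue_rV n) Y p /\ continuous p.

End processes.

(* Main.v *)
Require Import Defs.
From HB Require Import structures.
From mathcomp Require Import all_boot all_order all_algebra.
From mathcomp Require Import all_classical all_reals all_analysis.
From mathcomp Require Import measurable_realfun ring lra.
Set Implicit Arguments.
Unset Strict Implicit.
Unset Printing Implicit Defensive.
Import Order.TTheory GRing.Theory Num.Theory.
Import numFieldNormedType.Exports.
Local Open Scope classical_set_scope.
Local Open Scope ring_scope.

(* Let rho_t be the density of W_(S_t), i.e. the mean of the Gaussian kernel at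
   the random time S_t. The Laplace transform of S_t yields matching upper and
   lower bounds for negative exponential moments of S_t, and from these a Harnack
   inequality: rho_t(z - v) <= (1 + C |v| t^(-1/alpha)) rho_t(z) for
   |v| <= K t^(1/alpha).

   Along the scheme X_0 = x, X_(k+1) = X_k + h_k b(X_k) + Z_k, the noises Z_k are
   independent with density rho_(h_k), so by the semigroup property
   E rho_t(y - X_(k+1)) = E rho_(t + h_k)(y - X_k - h_k b(X_k)). If s = t + h_k is
   the time to go, the Harnack inequality removes the drift at the cost of a factor
   1 + C h_k s^(-1/alpha) <= exp(C' (s^theta - (s - h_k)^theta)), where
   theta = 1 - 1/alpha > 0. The product of these factors telescopes, and the
   density E rho_(h_N)(y - X_N - h_N b(X_N)) of X_(N+1) is at most
   exp(C' T^theta) rho_H(y - x), with H = h_0 + ... + h_N. *)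

(** * Negative moments of a stable law *)

(** The moment estimates use only the Laplace transform of [S t] and its almost sure positivity: the
    means of 1 - exp(-gamma u) are explicit, so functions of the random time are compared with
    combinations of these.

    The Harnack inequality comes from comparing moments, not from a gradient bound. Put beta =
    alpha/2 and a = max(q, t^(1/beta)). The moment of order m at q = |z|^2 is comparable to a^(-m) t
    a^(-beta), so raising m by one gains exactly a factor 1/a, which absorbs the growth of |z|^2.

    The condition alpha > 1 makes theta positive. A drift of length at most M h with h <= s <= T is
    then at most a constant times s^(1/alpha), hence in the range of the Harnack inequality, and
    s^(-1/alpha) is integrable at 0.

    The probabilistic obstacle is that [W] is evaluated at a random time, while nothing is assumed
    about its joint measurability in time and chance. A jointly measurable version is built from the
    continuous paths, and independence of [W] and [S] is used by replacing the common sample point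
    by two independent ones. *)

Section exponential_estimates.
Context {R : realType}.
Implicit Types m u x : R.

Lemma powRN_inv u m : 0 < u -> u `^ (- m) = u^-1 `^ m.
Proof. by move=> u0; rewrite -(powR_inv1 (ltW u0)) -powRrM mulN1r. Qed.

Lemma expRN_le_half x : 1 <= x -> expR (- x) <= 1 / 2.
Proof.
move=> x1; rewrite expRN -div1r ler_pM2l// lef_pV2 ?posrE ?expR_gt0//.
by apply: le_trans (expR_ge1Dx x); lra.
Qed.

Lemma half_le_1BexpRN x : 0 <= x <= 1 -> x / 2 <= 1 - expR (- x).
Proof.
move=> /andP[x0 x1]; have := expR_ge1Dx x.
rewrite expRN => h; have e0 : 0 < expR x := expR_gt0 x.
have : (expR x)^-1 <= (1 + x)^-1 by rewrite lef_pV2 ?posrE//; lra.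
have : (1 + x)^-1 <= 1 - x / 2.
  rewrite -[leLHS]mul1r ler_pdivrMr; last lra.
  nra.
lra.
Qed.

Lemma oneBexpRN_le x : 1 - expR (- x) <= x.
Proof. by have := expR_ge1Dx (- x); lra. Qed.

(** With v = 1/u >= 1, exp(v/2) dominates its Taylor term of degree N+1 >= m. *)
Lemma powRN_expR_bounded m : 0 <= m ->
  exists2 C : R, 0 < C & forall u, 0 < u -> u <= 1 ->
    u `^ (- m) * expR (- (1 / (2 * u))) <= C.
Proof.
move=> m0; pose N := Num.truncn m.
have mN : m <= N.+1%:R by apply: ltW; apply: truncnS_gt.
exists (2 ^+ N.+1 * (N.+1)`!%:R); first by rewrite mulr_gt0// ?exprn_gt0// ltr0n fact_gt0.
move=> u u0 u1; set v := u^-1.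
have v0 : 0 < v by rewrite invr_gt0.
have v1 : 1 <= v by rewrite invf_ge1.
have -> : 1 / (2 * u) = v / 2 by rewrite /v; field; lra.
have -> : u `^ (- m) = v `^ m.
  exact: powRN_inv.
have vm : v `^ m <= v ^+ N.+1.
  by rewrite -(powR_mulrn _ (ltW v0)); apply: ler_powR.
rewrite expRN ler_pdivrMr ?expR_gt0//; apply: (le_trans vm).
have := @expR_ge1Dxn _ (v / 2) N ltac:(lra).
have f0 : 0 < (N.+1)`!%:R :> R by rewrite ltr0n fact_gt0.
move=> h; have : (v / 2) ^+ N.+1 <= N.+1`!%:R * expR (v / 2).
  rewrite [leRHS]mulrC -ler_pdivrMr//; apply: le_trans h; lra.
rewrite expr_div_n ler_pdivrMr ?exprn_gt0// => h2.
by apply: (le_trans h2); rewrite [leLHS]mulrC mulrA.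
Qed.

Lemma powRN_expR_le m : 0 <= m ->
  exists2 C : R, 0 < C & forall u, 0 < u ->
    u `^ (- m) * expR (- (1 / (2 * u))) <= C * (1 - expR (- u)).
Proof.
(* Exponent m + 1 leaves a spare factor u, comparable to 1 - exp(-u) for u <= 1. For u > 1 the left
   side is at most 1 and 1 - exp(-u) is at least 1/2. *)
move=> m0; have [C C0 HC] := @powRN_expR_bounded (m + 1) ltac:(lra).
exists (2 * C + 2); first lra.
move=> u u0; have [u1|u1] := leP u 1.
  have := HC u u0 u1.
  rewrite opprD powRD; last by rewrite (gt_eqF u0) implybT.
  rewrite (powR_inv1 (ltW u0)) => h.
  have h2 : u `^ (- m) * expR (- (1 / (2 * u))) <= C * u.
    rewrite -ler_pdivrMr//; apply: le_trans h; rewrite le_eqVlt; apply/orP; left; apply/eqP; ring.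
  apply: (le_trans h2); have := half_le_1BexpRN (x := u).
  rewrite (ltW u0) u1 => /(_ isT); nra.
have h1 : expR (- u) <= 1 / 2 by apply: expRN_le_half; apply: ltW.
have h2 : u `^ (- m) <= 1.
  by rewrite -(powRr0 u) ler_powR//; lra.
have h3 : expR (- (1 / (2 * u))) <= 1 by rewrite expR_le1 oppr_le0 divr_ge0//; lra.
have h4 := expR_ge0 (- (1 / (2 * u))).
have h5 := powR_ge0 u (- m).
nra.
Qed.

(* A combination of exponentials below [u ^ -m * exp (-1 / 2u)]: it is negative
   near [0] and near infinity, yet its mean under a stable law of small scale
   is of the order of the scale. *)
Definition bump (eps L u : R) : R :=
  (1 - expR (- u)) - 2 * (1 - expR (- (eps * u))) - 2 / L * (1 - expR (- (L * u))).

Lemma bump_le (m eps L : R) : 0 <= m -> 0 < eps < 1 -> 1 < L ->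
  exists2 C : R, 0 < C & forall u, 0 < u ->
    bump eps L u <= C * (u `^ (- m) * expR (- (1 / (2 * u)))).
Proof.
move=> m0 /andP[e0 e1] L1.
exists ((eps `^ m)^-1 * expR (L / 2)).
  by rewrite mulr_gt0 ?expR_gt0// invr_gt0 powR_gt0.
move=> u u0.
have Fu : 0 <= (eps `^ m)^-1 * expR (L / 2) *
   (u `^ (- m) * expR (- (1 / (2 * u)))).
  by rewrite !mulr_ge0 ?expR_ge0 ?powR_ge0 ?invr_ge0 ?powR_ge0.
have p1 : 0 <= 1 - expR (- (eps * u)).
  by rewrite subr_ge0 expR_le1 oppr_le0 mulr_ge0// ltW.
have Lu0 : 0 < L * u by rewrite mulr_gt0//; lra.
have p2 : 0 <= 2 / L * (1 - expR (- (L * u))).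
  by rewrite mulr_ge0 ?divr_ge0 ?subr_ge0 ?expR_le1//; lra.
have p3 := expR_gt0 (- u).
(* For u <= 1/L the last term of [bump] already exceeds u >= 1 - exp(-u), and for u >= 1/eps the
   middle one exceeds 1. Only the compact range between them can give a positive value; there [bump]
   is at most 1 and the right side is bounded below. *)
have [Lu|Lu] := leP (L * u) 1.
  apply: le_trans Fu; rewrite /bump.
  have := @half_le_1BexpRN (L * u) ltac:(lra).
  rewrite -(ler_pM2l (x := 2 / L)) ?divr_gt0//; last lra.
  have -> : 2 / L * (L * u / 2) = u by field; lra.
  have := oneBexpRN_le u; lra.
have [eu|eu] := leP 1 (eps * u).
  apply: le_trans Fu; rewrite /bump; have := expRN_le_half eu; lra.
have h1 : bump eps L u <= 1 by rewrite /bump; lra.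
apply: (le_trans h1).
have uN : eps `^ m <= u `^ (- m).
  rewrite powRN_inv//.
  rewrite ge0_ler_powR ?nnegrE ?invr_ge0 ?(ltW u0) ?(ltW e0)//.
  by rewrite -[leRHS]mul1r ler_pdivlMr// ltW.
have e2 : expR (- (L / 2)) <= expR (- (1 / (2 * u))).
  rewrite ler_expR lerN2 ler_pdivrMr; last lra.
  by nra.
have E : (eps `^ m)^-1 * expR (L / 2) * (eps `^ m * expR (- (L / 2))) = 1.
  rewrite expRN; field; rewrite !gt_eqF ?powR_gt0 ?expR_gt0//.
rewrite -[leLHS]E; apply: ler_wpM2l.
  by rewrite mulr_ge0 ?expR_ge0// invr_ge0 powR_ge0.
by apply: ler_pM; rewrite ?powR_ge0 ?expR_ge0.
Qed.

(* Take [2 ^ k] comparable to [1 / u]. *)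
Lemma powRN_le_series (N : nat) u : 0 < u ->
  exists k : nat, u `^ (- N%:R) <= 1 + expR 2 * (2 ^+ k) ^+ N * expR (- (2 ^+ k * u)).
Proof.
move=> u0; have [u1|u1] := leP 1 u.
  exists 0%N; rewrite (@le_trans _ _ 1)//.
    by rewrite -[leRHS](powRr0 u) ler_powR// oppr_le0.
  by rewrite lerDl !mulr_ge0 ?expR_ge0 ?exprn_ge0.
have v1 : 1 <= u^-1 by rewrite invf_ge1// ltW.
have v0 : 0 <= u^-1 by lra.
have [k /andP[k1 k2]] : exists k : nat, 2 ^+ k <= u^-1 * 2 < 2 ^+ k.+1.
  have H : exists k : nat, u^-1 * 2 < 2 ^+ k.+1.
    exists (Num.truncn (u^-1 * 2)).+1; apply: (lt_trans (truncnS_gt _)).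
    apply: (@lt_trans _ _ (2 ^+ (Num.truncn (u^-1 * 2)).+1)).
      by rewrite -natrX ltr_nat ltn_expl.
    by rewrite ltr_eXn2l ?ltr1n.
  have [k k1 k2] := ex_minnP H; exists k; rewrite k1 andbT.
  case: k k1 k2 => [|k] k1 k2; first by rewrite expr0; lra.
  rewrite leNgt; apply/negP => /k2; by rewrite ltnn.
exists k.
have ku : 2 ^+ k * u <= 2.
  move: k1; rewrite -(ler_pM2r u0); rewrite -mulrA (mulrC 2) mulrA mulVf ?mul1r// gt_eqF//.
have uk : u^-1 <= 2 ^+ k by move: k2; rewrite exprS; lra.
rewrite (powR_invn _ (ltW u0)) -exprVn.
have h1 : (u^-1) ^+ N <= (2 ^+ k) ^+ N by rewrite lerXn2r ?nnegrE//; lra.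
have h2 : 1 <= expR 2 * expR (- (2 ^+ k * u)).
  by rewrite -expRD -[leLHS]expR0 ler_expR; lra.
have h3 : 0 <= u^-1 ^+ N by rewrite exprn_ge0.
rewrite (le_trans h1)// -mulrA [X in _ + _ * X]mulrC mulrA.
have h4 : 0 <= (2 ^+ k) ^+ N :> R by rewrite !exprn_ge0.
nra.
Qed.

(** With v = 2^k, the Taylor term of degree 2(N+1)+1 of exp(v^beta) is at least a multiple of
    v^(N+1), because beta > 1/2. *)
Lemma expRN_powR_summable (beta : R) (N : nat) : 1 / 2 < beta ->
  exists2 C : R, 0 < C & forall k : nat, (2 ^+ k) ^+ N * expR (- (2 ^+ k) `^ beta) <= C / 2 ^+ k.
Proof.
move=> b2; pose M := (2 * N.+1)%N.
exists (M.+1)`!%:R; first by rewrite ltr0n fact_gt0.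
move=> k; set v := 2 ^+ k : R.
have v1 : 1 <= v by rewrite exprn_ege1// ler1n.
have v0 : 0 < v by lra.
rewrite expRN ler_pdivlMr// mulrAC ler_pdivrMr ?expR_gt0// -exprSr.
have f0 : 0 < (M.+1)`!%:R :> R by rewrite ltr0n fact_gt0.
have := @expR_ge1Dxn _ (v `^ beta) M (powR_ge0 _ _).
move=> h; have : (v `^ beta) ^+ M.+1 <= M.+1`!%:R * expR (v `^ beta).
  rewrite [leRHS]mulrC -ler_pdivrMr//; apply: le_trans h; lra.
rewrite -powR_mulrn ?powR_ge0// -powRrM; apply: le_trans.
rewrite -(powR_mulrn _ (ltW v0)); apply: ler_powR => //.
have -> : M.+1%:R = 2 * N.+1%:R + 1 :> R by rewrite /M -natr1 natrM.
have : 0 <= N.+1%:R :> R by []. nra.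
Qed.

End exponential_estimates.

(** * Moments of a stable variable from its Laplace transform *)

Section stable_moments.
Context {R : realType} {dO : measure_display} {Omega : measurableType dO}.
Variables (P : probability Omega R) (beta : R).
Hypothesis hbeta : 1 / 2 < beta < 1.

(* The law of [tau ^ (1 / beta) * S_1] for a [beta]-stable subordinator [S]. *)
Definition stable_laplace (tau : R) (U : Omega -> R) :=
  forall gamma, 0 <= gamma ->
  (\int[P]_w (expR (- (gamma * U w)))%:E = (expR (- (tau * gamma `^ beta)))%:E)%E.

Lemma prob_integral_cst (r : \bar R) : (\int[P]_w r = r)%E.
Proof. by rewrite integral_cst//= probability_setT mule1. Qed.

Lemma measurable_powR_expR (m q : R) (U : Omega -> R) : measurable_fun setT U ->
  (forall w, 0 < U w) ->
  measurable_fun setT (fun w => U w `^ (- m) * expR (- (q / (2 * U w)))).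
Proof.
move=> mU U0.
have -> : (fun w => U w `^ (- m) * expR (- (q / (2 * U w)))) =
    (fun w => U w `^ (- m) * expR (- (q / 2 * U w `^ (- 1)))).
  apply/funext => w; rewrite powR_inv1 ?ltW//; congr (_ * expR (- _)).
  by rewrite invfM mulrA.
apply: measurable_funM; first exact: (measurableT_comp (@measurable_powR R _) mU).
apply: measurableT_comp => //; apply: measurableT_comp => //.
apply: measurable_funM => //.
exact: (measurableT_comp (@measurable_powR R _) mU).
Qed.

Lemma measurable_expRN (g : R) (U : Omega -> R) : measurable_fun setT U ->
  measurable_fun setT (fun w => expR (- (g * U w))).
Proof.
move=> mU; apply: measurableT_comp => //; apply: measurableT_comp => //.
exact: measurable_funM.
Qed.

Lemma integral_oneBexpRN (tau gamma : R) (U : Omega -> R) :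
  measurable_fun setT U -> (forall w, 0 < U w) -> stable_laplace tau U ->
  0 <= gamma ->
  (\int[P]_w (1 - expR (- (gamma * U w)))%:E = (1 - expR (- (tau * gamma `^ beta)))%:E)%E.
Proof.
move=> mU U0 lU g0; have me := measurable_expRN gamma mU.
have : (\int[P]_w (1 - expR (- (gamma * U w)))%:E + \int[P]_w (expR (- (gamma * U w)))%:E = 1)%E.
  rewrite -ge0_integralD//; first last.
  - exact/measurable_EFinP.
  - by apply/measurable_EFinP; apply: measurable_funB.
  - by move=> w _; rewrite lee_fin subr_ge0 expR_le1 oppr_le0 mulr_ge0// ltW.
  under eq_integral do rewrite -EFinD subrK.
  by rewrite prob_integral_cst.
rewrite lU// => h.
by rewrite EFinB -[X in (X - _)%E]h addeK.
Qed.

Lemma stable_moment_le (m : R) : 0 <= m -> exists2 C : R, 0 < C &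
  forall (tau : R) (U : Omega -> R), measurable_fun setT U -> (forall w, 0 < U w) ->
    stable_laplace tau U ->
  (\int[P]_w (U w `^ (- m) * expR (- (1 / (2 * U w))))%:E <= (C * tau)%:E)%E.
Proof.
move=> m0; have [C C0 HC] := powRN_expR_le m0; exists C => // tau U mU U0 lU.
apply: (@le_trans _ _ (C%:E * \int[P]_w (1 - expR (- (1 * U w)))%:E)%E).
  have mb : measurable_fun setT (fun w => 1 - expR (- (1 * U w))).
    by apply: measurable_funB => //; exact: measurable_expRN.
  rewrite -ge0_integralZl_EFin//; last 3 first.
  - by move=> w _; rewrite lee_fin subr_ge0 expR_le1 oppr_le0 mulr_ge0// ltW.
  - exact/measurable_EFinP.
  - exact: ltW.
  apply: ge0_le_integral => //.
  - by move=> w _; rewrite lee_fin mulr_ge0 ?powR_ge0 ?expR_ge0.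
  - exact/measurable_EFinP/measurable_powR_expR.
  - by apply/measurable_EFinP; apply: measurable_funM.
  - by move=> w _; rewrite (mul1r (U w)) -EFinM lee_fin; exact: HC.
rewrite (@integral_oneBexpRN tau)// powR1 mulr1 -EFinM lee_fin.
by apply: ler_wpM2l (oneBexpRN_le _); exact: ltW.
Qed.

(** The bound of [powRN_le_series] is summed over all k, so that it no longer depends on u. The
    Laplace transform turns exp(-2^k U) into exp(-(2^k)^beta), which makes the series of means
    converge. *)
Lemma stable_neg_moment_le (m : R) : 0 <= m -> exists2 C : R, 0 < C &
  forall (U : Omega -> R), measurable_fun setT U -> (forall w, 0 < U w) ->
    stable_laplace 1 U ->
  (\int[P]_w (U w `^ (- m))%:E <= C%:E)%E.
Proof.
move=> m0; pose N := (Num.truncn m).+1.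
have mN : m <= N%:R by apply: ltW; exact: truncnS_gt.
have [C C0 HC] := @expRN_powR_summable R beta N (andP hbeta).1.
exists (2 + expR 2 * (2 * C)).
  by have := expR_gt0 (2 : R); nra.
move=> U mU U0 lU.
pose f (k : nat) w := ((2 ^+ k) ^+ N * expR (- (2 ^+ k * U w)))%:E.
have mf k : measurable_fun setT (f k).
  by apply/measurable_EFinP; apply: measurable_funM => //; exact: measurable_expRN.
have f0 k w : (0 <= f k w)%E by rewrite lee_fin mulr_ge0 ?expR_ge0// !exprn_ge0.
have key w : ((U w `^ (- m))%:E <= 2%:E + (expR 2)%:E * \sum_(k <oo) f k w)%E.
  have h1 : U w `^ (- m) <= 1 + U w `^ (- N%:R).
    have [u1|u1] := leP 1 (U w).
      rewrite (@le_trans _ _ 1)//; last by rewrite lerDl powR_ge0.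
      by rewrite -[leRHS](powRr0 (U w)) ler_powR// oppr_le0.
    rewrite (@le_trans _ _ (U w `^ (- N%:R)))//; last by rewrite lerDr.
    by apply: ger_powR; [rewrite U0 ltW|rewrite lerN2].
  have [k hk] := @powRN_le_series R N _ (U0 w).
  apply: (@le_trans _ _ (2 + expR 2 * ((2 ^+ k) ^+ N * expR (- (2 ^+ k * U w))))%:E).
    rewrite lee_fin; apply: (le_trans h1); rewrite mulrA; lra.
  rewrite EFinD leeD2l// EFinM lee_wpmul2l ?lee_fin ?expR_ge0//.
  apply: le_trans (nneseries_lim_ge (P := xpredT) k.+1 (fun i _ _ => f0 i w)).
  by rewrite big_nat_recr//= leeDr// sume_ge0.
apply: (@le_trans _ _ (\int[P]_w (2%:E + (expR 2)%:E * \sum_(k <oo) f k w))%E).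
  apply: ge0_le_integral => //.
  - by move=> w _; rewrite lee_fin powR_ge0.
  - exact/measurable_EFinP/(measurableT_comp (@measurable_powR R _) mU).
  - apply: emeasurable_funD => //; apply: measurable_funeM.
    exact: ge0_emeasurable_sum.
have S0 w : (0 <= \sum_(k <oo) f k w)%E by exact: nneseries_ge0.
have mS : measurable_fun setT (fun w => \sum_(k <oo) f k w)%E.
  exact: ge0_emeasurable_sum.
rewrite ge0_integralD//; first last.
- exact: measurable_funeM.
- by move=> w _; rewrite mule_ge0// lee_fin expR_ge0.
rewrite prob_integral_cst (EFinD 2) leeD2l//.
rewrite ge0_integralZl_EFin ?expR_ge0//.
rewrite EFinM lee_wpmul2l ?lee_fin ?expR_ge0//.
rewrite integral_nneseries//.
(* The bound C / 2^k is read as 2C / 2^(k+1), whose sum over k is 2C. *)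
apply: le_trans (@epsilon_trick0 R (2 * C) xpredT ltac:(lra)).
apply: lee_nneseries => [k _ _|k _]; first exact: integral_ge0.
rewrite /f; under eq_integral do rewrite EFinM.
rewrite ge0_integralZl_EFin ?exprn_ge0//; last first.
  exact/measurable_EFinP/measurable_expRN.
rewrite lU ?exprn_ge0// mul1r -EFinM lee_fin natrX exprS.
apply: (le_trans (HC k)); rewrite le_eqVlt; apply/orP; left; apply/eqP.
by field; rewrite gt_eqF// exprn_gt0.
Qed.

Lemma stable_moment_ge (m : R) : 0 <= m -> exists2 c : R, 0 < c &
  forall (tau : R) (U : Omega -> R), measurable_fun setT U -> (forall w, 0 < U w) ->
    0 < tau <= 1 -> stable_laplace tau U ->
  ((c * tau)%:E <= \int[P]_w (U w `^ (- m) * expR (- (1 / (2 * U w))))%:E)%E.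
Proof.
move=> m0; have [b0 b1] : 1 / 2 < beta /\ beta < 1 by apply/andP.
(* Chosen so that eps^beta = 1/16 and L^beta = L/16, the latter possible because beta < 1. In the
   mean of [bump], the first term is at least tau/2 and the two subtracted ones are at most tau/8
   each, which leaves tau/4. *)
pose eps : R := (1 / 16) `^ (beta^-1); pose L : R := 16 `^ ((1 - beta)^-1).
have bn : beta != 0 by rewrite gt_eqF//; lra.
have bn' : 1 - beta != 0 by rewrite gt_eqF//; lra.
have eb : eps `^ beta = 1 / 16.
  by rewrite /eps -powRrM (mulVf bn) powRr1//; lra.
have Lb : L `^ (1 - beta) = 16.
  by rewrite /L -powRrM (mulVf bn') powRr1.
have e0 : 0 < eps by rewrite powR_gt0//; lra.
have L0 : 0 < L by rewrite powR_gt0//; lra.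
clearbody eps L.
have e1 : eps < 1.
  rewrite ltNge; apply/negP => /(ge0_ler_powR (r := beta)); rewrite !nnegrE.
  by rewrite eb powR1 => /(_ ltac:(lra) ltac:(lra) ltac:(lra)); lra.
have L1 : 1 < L.
  rewrite ltNge; apply/negP => /(ge0_ler_powR (r := 1 - beta)); rewrite !nnegrE.
  by rewrite Lb powR1 => /(_ ltac:(lra) ltac:(lra) ltac:(lra)); lra.
have LbL : L `^ beta = L / 16.
  have : L `^ beta * L `^ (1 - beta) = L.
    rewrite -powRD ?(gt_eqF L0) ?implybT// addrC subrK powRr1//; exact: ltW.
  rewrite Lb; lra.
have [C C0 HC] := @bump_le R m eps L m0 ltac:(lra) L1.
exists (C^-1 / 4); first by rewrite divr_gt0// invr_gt0.
move=> tau U mU U0 /andP[t0 t1] lU.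
pose F w := U w `^ (- m) * expR (- (1 / (2 * U w))).
have mF : measurable_fun setT F by exact: measurable_powR_expR.
have F0 w : 0 <= F w by rewrite mulr_ge0 ?powR_ge0 ?expR_ge0.
pose G g w := 1 - expR (- (g * U w)).
have mG g : measurable_fun setT (G g).
  by apply: measurable_funB => //; exact: measurable_expRN.
have G0 g w : 0 < g -> 0 <= G g w.
  by move=> g0; rewrite subr_ge0 expR_le1 oppr_le0 mulr_ge0// ltW.
have IG g : 0 < g -> (\int[P]_w (G g w)%:E = (1 - expR (- (tau * g `^ beta)))%:E)%E.
  by move=> g0; apply: (integral_oneBexpRN mU U0 lU); exact: ltW.
have K : (\int[P]_w (G 1 w)%:E <= C%:E * \int[P]_w (F w)%:E +
     (2%:E * \int[P]_w (G eps w)%:E + (2 / L)%:E * \int[P]_w (G L w)%:E))%E.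
  have H0 : 0 <= 2 / L by rewrite divr_ge0// ltW.
  have n1 w : (0 <= C%:E * (F w)%:E)%E by rewrite mule_ge0 ?lee_fin ?(ltW C0).
  have n2 w : (0 <= 2%:E * (G eps w)%:E)%E by rewrite mule_ge0 ?lee_fin ?G0.
  have n3 w : (0 <= (2 / L)%:E * (G L w)%:E)%E.
    by rewrite mule_ge0 ?lee_fin ?G0.
  rewrite -!ge0_integralZl_EFin//; first last.
  all: try by [exact/measurable_EFinP|exact: ltW].
  all: try by move=> w _; rewrite lee_fin ?G0.
  rewrite -!ge0_integralD//; first last.
  all: try by apply/measurable_EFinP; apply: measurable_funM.
  all: try by apply: emeasurable_funD => //; apply/measurable_EFinP; apply: measurable_funM.
  all: try by move=> w _; rewrite ?adde_ge0.
  apply: ge0_le_integral => //.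
  - by move=> w _; rewrite lee_fin G0.
  - exact/measurable_EFinP.
  - do 2?apply: emeasurable_funD => //; apply/measurable_EFinP; exact: measurable_funM.
  - move=> w _; rewrite -!EFinM -!EFinD lee_fin.
    have := HC _ (U0 w); rewrite /bump /G /F (mul1r (U w)); lra.
move: K; rewrite !IG// eb LbL powR1 mulr1.
set I := integral _ _ _.
have I0 : (0 <= I)%E by apply: integral_ge0 => w _; rewrite lee_fin.
case: I I0 => [r r0| _ _|//]; last by rewrite leey.
rewrite -!EFinM -!EFinD !lee_fin => K.
have h1 := @half_le_1BexpRN _ tau ltac:(lra).
have h2 := oneBexpRN_le (tau * (1 / 16)).
have h3 := oneBexpRN_le (tau * (L / 16)).
have h4 : 2 / L * (1 - expR (- (tau * (L / 16)))) <= tau / 8.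
  rewrite mulrAC ler_pdivrMr//; nra.
have h5 : tau / 4 <= C * r by lra.
by rewrite -mulrA ler_pdivrMl//; lra.
Qed.

End stable_moments.

(** * Gaussian kernels at a stable random time *)

Section stable_potential.
Context {R : realType} {dO : measure_display} {Omega : measurableType dO}.
Variables (P : probability Omega R) (beta : R).
Hypothesis hbeta : 1 / 2 < beta < 1.

(** For m = n/2 and q = |y|^2 this is, up to the factor (2 pi)^(-n/2), the mean at y of the Gaussian
    density with random variance Y. *)
Definition stable_phi (m : R) (Y : Omega -> R) (q : R) : \bar R :=
  (\int[P]_w (Y w `^ (- m) * expR (- (q / (2 * Y w))))%:E)%E.

Lemma stable_phi_ge0 m Y q : (0 <= stable_phi m Y q)%E.
Proof.
by apply: integral_ge0 => w _; rewrite lee_fin mulr_ge0 ?powR_ge0 ?expR_ge0.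
Qed.

Lemma le_stable_phi (m q q' : R) (Y : Omega -> R) : measurable_fun setT Y ->
  (forall w, 0 < Y w) -> q' <= q -> (stable_phi m Y q <= stable_phi m Y q')%E.
Proof.
move=> mY Y0 qq; apply: ge0_le_integral => //.
- by move=> w _; rewrite lee_fin mulr_ge0 ?powR_ge0 ?expR_ge0.
- exact/measurable_EFinP/measurable_powR_expR.
- exact/measurable_EFinP/measurable_powR_expR.
move=> w _; rewrite lee_fin ler_wpM2l ?powR_ge0// ler_expR lerN2.
by rewrite ler_wpM2r// invr_ge0 mulr_ge0// ltW.
Qed.

Lemma stable_laplace_scale (t a : R) (Y : Omega -> R) : 0 < a ->
  stable_laplace P beta t Y -> stable_laplace P beta (t * a `^ (- beta)) (fun w => Y w / a).
Proof.
move=> a0 lY g g0.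
have -> : (fun w => (expR (- (g * (Y w / a))))%:E) = (fun w => (expR (- (g / a * Y w)))%:E).
  by apply/funext => w; congr (expR (- _))%:E; field; rewrite gt_eqF.
rewrite lY ?divr_ge0 ?(ltW a0)//; congr (expR (- _))%:E.
by rewrite powRM ?invr_ge0 ?(ltW a0)// -powRN_inv// -mulrA; congr (_ * _); rewrite mulrC.
Qed.

Lemma stable_phi_scale (m q a : R) (Y : Omega -> R) : measurable_fun setT Y ->
  (forall w, 0 < Y w) -> 0 < a ->
  (stable_phi m Y q = (a `^ (- m))%:E * stable_phi m (fun w => Y w / a)%R (q / a)%R)%E.
Proof.
move=> mY Y0 a0; have V0 w : 0 < Y w / a by rewrite divr_gt0.
have mV : measurable_fun setT (fun w => Y w / a) by exact: measurable_funM.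
rewrite -ge0_integralZl_EFin ?powR_ge0//.
- apply: eq_integral => w _; rewrite -EFinM; congr EFin.
  rewrite [RHS]mulrA; congr (_ * expR (- _)).
    by rewrite -powRM ?(ltW a0) ?(ltW (V0 w))//; congr (_ `^ _); field; rewrite gt_eqF.
  by field; rewrite !gt_eqF.
- by move=> w _; rewrite lee_fin mulr_ge0 ?powR_ge0 ?expR_ge0.
- exact/measurable_EFinP/measurable_powR_expR.
Qed.

Lemma stable_time_le1 (t a : R) : 0 < t -> t `^ beta^-1 <= a -> 0 < t * a `^ (- beta) <= 1.
Proof.
move=> t0 ta; have b0 : 0 < beta by case/andP: hbeta => ? ?; lra.
have a0 : 0 < a by apply: lt_le_trans ta; rewrite powR_gt0.
rewrite mulr_gt0 ?powR_gt0//= powRN ler_pdivrMr ?powR_gt0// mul1r.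
rewrite -[leLHS]powRr1 ?(ltW t0)// -(mulVf (lt0r_neq0 b0)) powRrM.
by rewrite ge0_ler_powR ?nnegrE ?powR_ge0 ?(ltW a0) ?(ltW b0).
Qed.

(** Dividing Y by a brings the time parameter below 1 and q/a below 1, the situation of
    [stable_moment_ge]. The scale a is left free because the Harnack inequality compares two values
    of q at one common scale. *)
Lemma stable_phi_ge (m : R) : 0 <= m -> exists2 c : R, 0 < c &
  forall (t q a : R) (Y : Omega -> R), measurable_fun setT Y ->
    (forall w, 0 < Y w) -> 0 < t -> stable_laplace P beta t Y ->
    t `^ beta^-1 <= a -> q <= a ->
  ((c * (a `^ (- m) * (t * a `^ (- beta))))%:E <= stable_phi m Y q)%E.
Proof.
move=> m0; have [c c0 H] := stable_moment_ge P hbeta m0; exists c => //.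
move=> t q a Y mY Y0 t0 lY ta qa.
have a0 : 0 < a by apply: lt_le_trans ta; rewrite powR_gt0.
rewrite (stable_phi_scale _ _ mY Y0 a0).
have V0 w : 0 < Y w / a by rewrite divr_gt0.
have mV : measurable_fun setT (fun w => Y w / a) by exact: measurable_funM.
have := H _ _ mV V0 (stable_time_le1 t0 ta) (stable_laplace_scale a0 lY).
move=> h; rewrite mulrCA EFinM lee_wpmul2l ?lee_fin ?powR_ge0//.
apply: (le_trans h); apply: le_stable_phi => //.
by rewrite ler_pdivrMr// mul1r.
Qed.

Lemma stable_phi_le (m : R) : 0 <= m -> exists2 C : R, 0 < C &
  forall (t q : R) (Y : Omega -> R), measurable_fun setT Y ->
    (forall w, 0 < Y w) -> 0 < t -> stable_laplace P beta t Y -> 0 <= q ->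
  (stable_phi m Y q <= (C * ((Num.max q (t `^ beta^-1)) `^ (- m) *
     (t * (Num.max q (t `^ beta^-1)) `^ (- beta))))%:E)%E.
Proof.
move=> m0; have [C1 C10 H1] := stable_moment_le P beta m0.
have [C2 C20 H2] := stable_neg_moment_le P hbeta m0.
exists (Num.max C1 C2); first by rewrite lt_max C10.
move=> t q Y mY Y0 t0 lY q0; set a0 := t `^ beta^-1; set a := Num.max q a0.
have a00 : 0 < a0 by rewrite powR_gt0.
have ap : 0 < a by rewrite lt_max a00 orbT.
have V0 w : 0 < Y w / a by rewrite divr_gt0.
have mV : measurable_fun setT (fun w => Y w / a) by exact: measurable_funM.
have lV := stable_laplace_scale ap lY.
have /andP[T0 T1] : 0 < t * a `^ (- beta) <= 1.
  by apply: stable_time_le1 => //; rewrite le_max lexx orbT.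
rewrite (stable_phi_scale _ _ mY Y0 ap) mulrCA EFinM lee_wpmul2l ?lee_fin ?powR_ge0//.
have [qa|qa] := leP a0 q.
  have aq : a = q by rewrite /a; apply/max_idPl.
  apply: (@le_trans _ _ (C1 * (t * a `^ (- beta)))%:E).
    have := H1 _ _ mV V0 lV; apply: le_trans.
    by rewrite (_ : q / a = 1)// -aq divff// gt_eqF.
  by rewrite lee_fin ler_wpM2r ?(ltW T0)// le_max lexx.
have aq : a = a0 by rewrite /a; apply/max_idPr; exact: ltW.
have T11 : t * a `^ (- beta) = 1.
  have b0 : beta != 0 by case/andP: hbeta => ? ?; rewrite gt_eqF//; lra.
  by rewrite aq /a0 powRN -powRrM (mulVf b0) powRr1 ?(ltW t0)// divff// gt_eqF.
rewrite T11 mulr1 in lV *.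
apply: (@le_trans _ _ C2%:E); last by rewrite lee_fin le_max lexx orbT.
apply: le_trans (H2 _ mV V0 lV); apply: ge0_le_integral => //.
- by move=> w _; rewrite lee_fin mulr_ge0 ?powR_ge0 ?expR_ge0.
- exact/measurable_EFinP/measurable_powR_expR.
- by apply/measurable_EFinP; exact: (measurableT_comp (@measurable_powR R _) mV).
move=> w _; rewrite lee_fin -[leRHS]mulr1 ler_wpM2l ?powR_ge0// expR_le1 oppr_le0.
by rewrite !divr_ge0 ?mulr_ge0 ?(ltW ap) ?(ltW (Y0 w)) ?invr_ge0 ?(ltW ap).
Qed.

(** Pointwise this is 1 - exp(-x) <= x with x = (q' - q)/(2Y); the factor 1/Y raises the order from
    m to m + 1. *)
Lemma stable_phi_diff (m q q' : R) (Y : Omega -> R) : measurable_fun setT Y ->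
  (forall w, 0 < Y w) -> 0 <= q <= q' ->
  (stable_phi m Y q <= stable_phi m Y q' + ((q' - q) / 2)%:E * stable_phi (m + 1) Y q)%E.
Proof.
move=> mY Y0 /andP[q0 qq'].
have h0 : 0 <= (q' - q) / 2 by lra.
have mF m' q'' : measurable_fun setT (fun w => (Y w `^ (- m') * expR (- (q'' / (2 * Y w))))%:E).
  exact/measurable_EFinP/measurable_powR_expR.
have F0 m' q'' w : (0 <= (Y w `^ (- m') * expR (- (q'' / (2 * Y w))))%:E)%E.
  by rewrite lee_fin mulr_ge0 ?powR_ge0 ?expR_ge0.
rewrite -ge0_integralZl_EFin// -ge0_integralD//; last 2 first.
- by move=> w _; rewrite mule_ge0.
- exact: measurable_funeM.
apply: ge0_le_integral => //.
- apply: emeasurable_funD => //; exact: measurable_funeM.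
move=> w _; rewrite -EFinM -EFinD lee_fin.
rewrite opprD powRD ?(gt_eqF (Y0 w)) ?implybT// powR_inv1 ?(ltW (Y0 w))//.
have -> : expR (- (q' / (2 * Y w))) = expR (- (q / (2 * Y w))) * expR (- ((q' - q) / (2 * Y w))).
  by rewrite -expRD; congr expR; field; rewrite gt_eqF.
have := oneBexpRN_le ((q' - q) / (2 * Y w)).
set E1 := expR (- (q / _)); set E2 := expR _ => h.
have -> : (q' - q) / 2 * (Y w `^ (- m) * (Y w)^-1 * E1) = Y w `^ (- m) * E1 * ((q' - q) / (2 * Y w)).
  by field; rewrite gt_eqF.
have : 0 <= Y w `^ (- m) * E1 by rewrite mulr_ge0 ?powR_ge0 ?expR_ge0.
nra.
Qed.

(* Harnack inequality for the subordinated Gaussian kernel, as a function of the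
   norm: the two-sided bounds turn the increment of [stable_phi m] into a multiple
   of [stable_phi m] itself. *)
Lemma stable_phi_harnack (m K : R) : 0 <= m -> 0 <= K -> exists2 C : R, 0 < C &
  forall (t r r' rho : R) (Y : Omega -> R), measurable_fun setT Y ->
    (forall w, 0 < Y w) -> 0 < t -> stable_laplace P beta t Y ->
    0 <= r -> 0 <= r' -> r' <= r + rho -> 0 <= rho <= K * t `^ (2 * beta)^-1 ->
  (stable_phi m Y (r ^+ 2) <=
     (1 + C * (rho * t `^ (- (2 * beta)^-1)))%:E * stable_phi m Y (r' ^+ 2))%E.
Proof.
move=> m0 K0.
have [c c0 Hc] := stable_phi_ge m0.
have [C C0 HC] := @stable_phi_le (m + 1) ltac:(lra).
have b0 : 0 < beta by case/andP: hbeta => ? ?; lra.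
(* The loss in the lower bound when its scale grows from A^2 to ((1+K)A)^2, where A = max(r, t^(1/(2
   beta))). The larger scale is needed because r' <= r + rho <= (1+K)A. *)
pose D := ((1 + K) ^+ 2) `^ (m + beta).
have D0 : 0 < D by rewrite powR_gt0// exprn_gt0//; lra.
exists ((2 + K) / 2 * C / c * D).
  by rewrite mulr_gt0// divr_gt0// mulr_gt0// ; lra.
move=> t r r' rho Y mY Y0 t0 lY r0 r'0 r'r /andP[rho0 rhoK].
set th := t `^ (2 * beta)^-1 in rhoK *.
have th0 : 0 < th by rewrite powR_gt0.
have thE : t `^ beta^-1 = th ^+ 2.
  rewrite -powR_mulrn ?powR_ge0// /th -powRrM; congr (_ `^ _); field.
  by rewrite gt_eqF.
have -> : t `^ (- (2 * beta)^-1) = th^-1 by rewrite powRN.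
have CC0 : 0 <= (2 + K) / 2 * C / c * D * (rho / th).
  rewrite mulr_ge0 ?divr_ge0 ?(ltW th0)// mulr_ge0 ?(ltW D0)//.
  by rewrite !mulr_ge0 ?invr_ge0 ?(ltW c0) ?(ltW C0)//; lra.
(* Moving inwards only increases the kernel; the estimates are needed for r < r'. *)
have [rr|rr] := leP r' r.
  apply: (@le_trans _ _ (stable_phi m Y (r' ^+ 2))).
    by apply: le_stable_phi => //; rewrite lerXn2r.
  rewrite -[leLHS]mul1e lee_wpmul2r ?stable_phi_ge0// lee_fin; lra.
have q12 : 0 <= r ^+ 2 <= r' ^+ 2 by rewrite sqr_ge0/= lerXn2r// ltW.
apply: (le_trans (stable_phi_diff m mY Y0 q12)).
rewrite (EFinD 1) ge0_muleDl ?lee_fin// mul1e leeD2l//.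
have := HC t (r ^+ 2) Y mY Y0 t0 lY (sqr_ge0 _).
rewrite thE; set A := Num.max r th.
have A0 : 0 < A by rewrite lt_max th0 orbT.
have Ar : r <= A by rewrite le_max lexx.
have Ath : th <= A by rewrite le_max lexx orbT.
have -> : Num.max (r ^+ 2) (th ^+ 2) = A ^+ 2.
  rewrite /A; have [h|h] := leP r th.
    by apply/max_idPr; rewrite lerXn2r ?nnegrE ?(ltW th0).
  by apply/max_idPl; rewrite lerXn2r ?nnegrE ?(ltW th0) ?(ltW h).
have := Hc t (r' ^+ 2) (((1 + K) * A) ^+ 2) Y mY Y0 t0 lY.
have KA : r' <= (1 + K) * A by nra.
rewrite thE lerXn2r ?nnegrE ?(ltW th0)//; last 2 first.
  by rewrite mulr_ge0 ?(ltW A0)//; lra.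
  by nra.
rewrite lerXn2r ?nnegrE//; last by rewrite mulr_ge0 ?(ltW A0)//; lra.
move=> /(_ isT isT); set X := stable_phi m Y _; set Z := stable_phi _ Y _.
pose B := (A ^+ 2) `^ (- m) * (t * (A ^+ 2) `^ (- beta)).
have B0 : 0 < B by rewrite !mulr_gt0// powR_gt0// exprn_gt0.
have K2 : 0 < (1 + K) ^+ 2 by rewrite exprn_gt0//; lra.
have A2 : 0 < A ^+ 2 by rewrite exprn_gt0.
have -> : (((1 + K) * A) ^+ 2) `^ (- m) * (t * (((1 + K) * A) ^+ 2) `^ (- beta)) = B / D.
  rewrite exprMn !(@powRM R ((1 + K) ^+ 2) (A ^+ 2)) ?(ltW K2) ?(ltW A2)// /B /D.
  have -> : (((1 + K) ^+ 2) `^ (m + beta))^-1 = ((1 + K) ^+ 2) `^ (- m) * ((1 + K) ^+ 2) `^ (- beta).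
    by rewrite -powRN opprD powRD// (gt_eqF K2) implybT.
  ring.
have -> : (A ^+ 2) `^ (- (m + 1)) * (t * (A ^+ 2) `^ (- beta)) = B / A ^+ 2.
  rewrite opprD powRD ?(gt_eqF A2) ?implybT// powR_inv1 ?(ltW A2)// /B; ring.
move=> hX hZ.
apply: (@le_trans _ _ ((r' ^+ 2 - r ^+ 2) / 2 * (C * (B / A ^+ 2)))%:E).
  rewrite [leRHS]EFinM lee_wpmul2l// lee_fin; case/andP: q12; lra.
apply: (@le_trans _ _ ((2 + K) / 2 * C / c * D * (rho / th) * (c * (B / D)))%:E); last first.
  by rewrite [leLHS]EFinM lee_wpmul2l.
have -> : (2 + K) / 2 * C / c * D * (rho / th) * (c * (B / D)) = (2 + K) / 2 * C * B * rho / th.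
  by field; rewrite !gt_eqF.
have -> : (r' ^+ 2 - r ^+ 2) / 2 * (C * (B / A ^+ 2)) = C * B / 2 * ((r' ^+ 2 - r ^+ 2) / A ^+ 2).
  by field; rewrite gt_eqF.
have -> : (2 + K) / 2 * C * B * rho / th = C * B / 2 * ((2 + K) * rho / th).
  by field; rewrite gt_eqF.
have CB : 0 <= C * B / 2 by apply: divr_ge0 => //; exact/ltW/mulr_gt0.
rewrite lee_fin; apply: (ler_wpM2l CB).
(* Factor the difference: r' - r <= rho, and r' + r <= 2r + rho <= (2+K)A. Division by A^2 leaves
   one factor 1/A, which is at most 1/th. *)
have h1 : r' ^+ 2 - r ^+ 2 <= (2 + K) * rho * A by nra.
apply: (@le_trans _ _ ((2 + K) * rho / A)).
  rewrite ler_pdivrMr// expr2 mulrA -[(_ / A) * A]mulrA mulVf ?mulr1//.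
  by rewrite gt_eqF.
rewrite ler_wpM2l ?mulr_ge0//; first lra.
by rewrite lef_pV2 ?posrE.
Qed.

End stable_potential.

(** * Lebesgue measure and Gaussian kernels on row vectors *)

Section lebesgue_rV_theory.
Context {R : realType}.

Definition rV_tail (n : nat) (x : 'rV[R]_n.+1) : 'rV[R]_n :=
  \row_(i < n) x ord0 (lift ord0 i).

Lemma rV_consK n (z : 'rV[R]_n * measurableTypeR R) :
  rV_tail (rV_cons z) = z.1 /\ rV_cons z ord0 ord0 = z.2.
Proof.
split; last by rewrite mxE unlift_none.
by apply/rowP => i; rewrite !mxE liftK.
Qed.

Lemma measurable_rV_tail n : measurable_fun setT (@rV_tail n).
Proof.
apply/measurable_fun_rVP => i.
rewrite (_ : (fun _ => _) = fun x : 'rV[R]_n.+1 => x ord0 (lift ord0 i)); last first.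
  by apply/funext => x; rewrite mxE.
exact: measurable_rV_coord.
Qed.

(* [lebesgue_rV], under a name able to carry the sigma-finite structure. *)
Definition leb (n : nat) : set 'rV[R]_n -> \bar R := @lebesgue_rV R n.

HB.instance Definition _ n := Measure.copy (@leb n) (@lebesgue_rV R n).

Lemma leb_succE n (A : set 'rV[R]_n.+1) :
  leb A = ((@leb n) \x lebesgue_measure)%E (@rV_cons R n @^-1` A).
Proof. by []. Qed.

Lemma leb_sigma_finite n : sigma_finite setT (@leb n).
Proof.
elim: n => [|n [F FT mF]].
  exists (fun=> setT); first by rewrite bigcup_const//; exists 0%N.
  by move=> _; split => //; rewrite /leb /= /dirac indicE in_setT ltry.
(* The exhaustion is made nondecreasing so that one index serves both the tail and the first
   coordinate. *)
have /sigma_finiteP[G [GT ndG mG]] : sigma_finite setT (@leb n) by exists F.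
exists (fun k => (@rV_tail n) @^-1` (G k) `&`
    (fun x : 'rV[R]_n.+1 => x ord0 ord0) @^-1` `[- k%:R, k%:R]%classic).
  apply/esym; rewrite -subTset => x _.
  have : setT (rV_tail x) by [].
  rewrite GT => -[k _ Gk].
  exists (maxn k (Num.truncn `|x ord0 ord0|).+1) => //; split => /=.
    by have /subsetPset := ndG _ _ (leq_maxl k (Num.truncn `|x ord0 ord0|).+1); exact.
  rewrite in_itv/= -ler_norml; apply: (le_trans (ltW (truncnS_gt _))).
  by rewrite ler_nat leq_maxr.
move=> k; have [mGk Gkoo] := mG k.
have mI : measurable `[- k%:R : R, k%:R]%classic by exact: measurable_itv.
split.
  apply: measurableI.
    by rewrite -[X in measurable X]setTI; exact: measurable_rV_tail.
  rewrite -[X in measurable X]setTI; exact: measurable_rV_coord.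
rewrite leb_succE (_ : _ @^-1` _ = G k `*` `[- k%:R, k%:R]%classic); last first.
  by apply/seteqP; split => z /=; have [-> ->] := rV_consK z.
rewrite product_measure1E// lte_mul_pinfty// ?ge0_fin_numE//.
by rewrite /= lebesgue_measure_itv/=; case: ifP => _; rewrite ?ltry// -EFinB ltry.
Qed.

HB.instance Definition _ n := Measure_isSigmaFinite.Build _ _ _ (@leb n)
  (@leb_sigma_finite n).

Lemma integral_leb_succ n (f : 'rV[R]_n.+1 -> \bar R) :
  measurable_fun setT f -> (forall x, 0 <= f x)%E ->
  (\int[@leb n.+1]_x f x =
   \int[@leb n]_z \int[lebesgue_measure]_a f (rV_cons (z, a)))%E.
Proof.
move=> mf f0.
rewrite -[LHS]/(\int[pushforward ((@leb n) \x lebesgue_measure)%E (@rV_cons R n)]_x f x)%E.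
rewrite ge0_integral_pushforward//; last exact: measurable_rV_cons.
rewrite preimage_setT fubini_tonelli1//; last by move=> x; exact: f0.
apply: measurableT_comp => //; exact: measurable_rV_cons.
Qed.

Lemma integral_leb0 (f : 'rV[R]_0 -> \bar R) :
  measurable_fun setT f -> (\int[@leb 0]_x f x = f 0%R)%E.
Proof. by move=> mf; rewrite -[LHS]/(\int[\d_ (0%R : 'rV[R]_0)]_x f x)%E integral_dirac// diracE in_setT mul1e. Qed.

Lemma lebesgue_measure_translate (c : R) (A : set R) : measurable A ->
  pushforward lebesgue_measure (fun a : measurableTypeR R => (a + c : measurableTypeR R)) A = lebesgue_measure A.
Proof.
move=> mA; apply/esym.
have mt : measurable_fun setT (fun a : measurableTypeR R => (a + c : measurableTypeR R)).
  exact: measurable_funD.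
pose nu := measure_function_pushforward__canonical__measure_function_Measure lebesgue_measure mt.
apply: (@lebesgue_measure_unique R nu) => // _ [[a b]] _ <-.
rewrite /nu /= /pushforward.
have -> : (fun x => x + c) @^-1` `]a, b]%classic = `]a - c, b - c]%classic.
  by apply/seteqP; split => x /=; rewrite !in_itv/= ltrBlDr lerBrDr.
by rewrite !lebesgue_measure_itv/= !lte_fin ltrD2r -!EFinB; case: ifP => // _; congr EFin; ring.
Qed.

Lemma integral_lebesgue_translate (c : R) (f : R -> \bar R) :
  measurable_fun setT f -> (forall x, 0 <= f x)%E ->
  (\int[lebesgue_measure]_a f (a + c)%R = \int[lebesgue_measure]_a f a)%E.
Proof.
move=> mf f0.
transitivity (\int[pushforward lebesgue_measure (fun a : measurableTypeR R => (a + c : measurableTypeR R)%R)]_a f a)%E.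
  rewrite ge0_integral_pushforward//; exact: measurable_funD.
apply: eq_measure_integral => [|mt A mA _]; first exact: measurable_funD.
exact: lebesgue_measure_translate.
Qed.

Lemma measurable_rV_add n (v : 'rV[R]_n) : measurable_fun setT (fun x : 'rV[R]_n => x + v).
Proof.
apply/measurable_fun_rVP => i.
rewrite (_ : (fun _ => _) = fun x : 'rV[R]_n => x ord0 i + v ord0 i); last first.
  by apply/funext => x; rewrite mxE.
apply: measurable_funD => //; exact: measurable_rV_coord.
Qed.

Lemma integral_leb_translate n (v : 'rV[R]_n) (f : 'rV[R]_n -> \bar R) :
  measurable_fun setT f -> (forall x, 0 <= f x)%E ->
  (\int[@leb n]_x f (x + v)%R = \int[@leb n]_x f x)%E.
Proof.
elim: n v f => [|n IH] v f mf f0.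
  have mfv : measurable_fun setT (fun x : 'rV[R]_0 => f (x + v)).
    by apply: (measurableT_comp mf); exact: measurable_rV_add.
  by rewrite !integral_leb0// [0 + v]thinmx0 .
have mfv : measurable_fun setT (fun x : 'rV[R]_n.+1 => f (x + v)).
  by apply: (measurableT_comp mf); exact: measurable_rV_add.
have mcons : measurable_fun setT (fun z => f (@rV_cons R n z)).
  by apply: (measurableT_comp mf); exact: measurable_rV_cons.
rewrite !integral_leb_succ//.
pose G z := (\int[lebesgue_measure]_a f (@rV_cons R n (z, a)))%E.
have mG : measurable_fun setT G by exact: measurable_fun_fubini_tonelli_F mcons _.
have G0 z : (0 <= G z)%E by exact: integral_ge0.
rewrite -[RHS](IH (rV_tail v) G mG G0); apply: eq_integral => z _.
rewrite /G -[RHS](integral_lebesgue_translate (v ord0 ord0))//.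
  apply: eq_integral => a _; congr f; apply/rowP => i; rewrite !mxE.
  by case: unliftP => [j ->|->]//=; rewrite !mxE.
by apply: (measurableT_comp mcons); exact: measurable_fun_pair.
Qed.

End lebesgue_rV_theory.

(** * Convolution of Gaussian kernels *)

Section gaussian_kernel.
Context {R : realType}.
Implicit Types (s r a c : R).

Lemma measurable_invr : measurable_fun setT (fun x : R => x^-1).
Proof.
rewrite (_ : (fun _ => _) = fun x : R => x * (x ^+ 2) `^ (- 1)).
  apply: measurable_funM => //.
  by apply: (measurableT_comp (@measurable_powR R _)); exact: measurable_funX.
apply/funext => x; rewrite powR_inv1 ?sqr_ge0//.
have [->|x0] := eqVneq x 0; first by rewrite invr0 mul0r.
by field.
Qed.

Lemma enorm_sqr n (x : 'rV[R]_n) : enorm x ^+ 2 = \sum_(i < n) x ord0 i ^+ 2.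
Proof. by rewrite sqr_sqrtr// sumr_ge0// => i _; exact: sqr_ge0. Qed.

Lemma enorm_ge0 n (x : 'rV[R]_n) : 0 <= enorm x.
Proof. exact: sqrtr_ge0. Qed.

Lemma measurable_enorm_sqr d (T : measurableType d) n (f : T -> 'rV[R]_n) :
  measurable_fun setT f -> measurable_fun setT (fun w => enorm (f w) ^+ 2).
Proof.
move=> /measurable_fun_rVP mf.
rewrite (_ : (fun _ => _) = fun w => \sum_(i < n) f w ord0 i ^+ 2).
  by apply: measurable_sum => i; exact: measurable_funX.
by apply/funext => w; rewrite enorm_sqr.
Qed.

Lemma measurable_gauss_density d (T : measurableType d) n (s : T -> R) (f : T -> 'rV[R]_n) :
  measurable_fun setT s -> measurable_fun setT f ->
  measurable_fun setT (fun w => gauss_density (s w) (f w)).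
Proof.
move=> ms mf; apply: measurable_funM.
  by apply: (measurableT_comp (@measurable_powR R _)); exact: measurable_funM.
apply: measurableT_comp => //; apply: measurableT_comp => //.
apply: measurable_funM; first exact: measurable_enorm_sqr.
by apply: (measurableT_comp measurable_invr); exact: measurable_funM.
Qed.

Lemma gauss_density_ge0 n s (x : 'rV[R]_n) : 0 <= gauss_density s x.
Proof. by rewrite mulr_ge0 ?powR_ge0 ?expR_ge0. Qed.

Definition gauss1 s a : R := (2 * pi * s) `^ (- (1 / 2)) * expR (- (a ^+ 2 / (2 * s))).

Lemma gauss_density_succ n s (x : 'rV[R]_n.+1) : 0 < s ->
  gauss_density s x = gauss_density s (rV_tail x) * gauss1 s (x ord0 ord0).
Proof.
move=> s0; rewrite /gauss_density /gauss1 mulrACA; congr (_ * _).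
  have h : 0 < 2 * pi * s by rewrite !mulr_gt0// pi_gt0.
  rewrite -powRD ?(gt_eqF h) ?implybT//; congr (_ `^ _).
  by rewrite -natr1; field.
rewrite -expRD; congr expR; rewrite !enorm_sqr big_ord_recl.
under [X in _ = - (X / _) - _]eq_bigr do rewrite mxE.
by rewrite mulrDl opprD addrC.
Qed.

Lemma gauss_density0 s (x : 'rV[R]_0) : gauss_density s x = 1.
Proof.
by rewrite /gauss_density mul0r oppr0 powRr0 enorm_sqr big_ord0 mul0r oppr0 expR0 mulr1.
Qed.

Lemma gauss1_normal_pdf s a c : 0 < s -> gauss1 s (a - c) = normal_pdf c (Num.sqrt s) a.
Proof.
move=> s0; rewrite normal_pdfE ?sqrtr_eq0 -?ltNge//.
rewrite /gauss1 /normal_peak /normal_fun sqr_sqrtr ?(ltW s0)//; congr (_ * expR _).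
  rewrite powRN div1r powR12_sqrt ?mulr_ge0 ?pi_ge0 ?(ltW s0)//.
  by congr (Num.sqrt _)^-1; rewrite -mulr_natr; ring.
by rewrite -[s *+ 2]mulr_natr mulNr (mulrC s).
Qed.

(** Completing the square in a. The second factor on the right is a normal density in a, so
    integrating it out gives the convolution formula. *)
Lemma gauss1_mul s r a c : 0 < s -> 0 < r ->
  gauss1 s (c - a) * gauss1 r a =
  gauss1 (s + r) c * gauss1 (s * r / (s + r)) (a - c * r / (s + r)).
Proof.
move=> s0 r0; have sr0 : 0 < s + r by rewrite addr_gt0.
have p0 : 0 < pi :> R by exact: pi_gt0.
have q0 : 0 < s * r / (s + r) by rewrite divr_gt0 ?mulr_gt0.
have pw : (2 * pi * s) `^ (- (1 / 2)) * (2 * pi * r) `^ (- (1 / 2)) =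
    (2 * pi * (s + r)) `^ (- (1 / 2)) * (2 * pi * (s * r / (s + r))) `^ (- (1 / 2)).
  by rewrite -!powRM;
    [congr (_ `^ _); field; rewrite gt_eqF|apply: ltW; rewrite !mulr_gt0 ?invr_gt0..].
rewrite /gauss1 mulrACA pw [RHS]mulrACA -!expRD; congr (_ * expR _).
by field; rewrite !gt_eqF.
Qed.

Lemma integral_gauss1_conv s r c : 0 < s -> 0 < r ->
  (\int[lebesgue_measure]_a (gauss1 s (c - a) * gauss1 r a)%:E = (gauss1 (s + r) c)%:E)%E.
Proof.
move=> s0 r0; have sr0 : 0 < s * r / (s + r) by rewrite divr_gt0 ?mulr_gt0 ?addr_gt0.
under eq_integral do rewrite gauss1_mul// (gauss1_normal_pdf _ _ sr0) EFinM.
rewrite ge0_integralZl_EFin//; first by rewrite integral_normal_pdf mule1.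
- by move=> a _; rewrite lee_fin normal_pdf_ge0.
- apply/measurable_EFinP; exact: measurable_normal_pdf.
- by rewrite mulr_ge0 ?powR_ge0 ?expR_ge0.
Qed.

Lemma measurable_gauss_conv n s r (v : 'rV[R]_n) :
  measurable_fun setT (fun z : 'rV[R]_n => (gauss_density s (v - z) * gauss_density r z)%:E).
Proof.
apply/measurable_EFinP; apply: measurable_funM; apply: measurable_gauss_density => //.
apply/measurable_fun_rVP => i.
rewrite (_ : (fun _ => _) = fun z : 'rV[R]_n => v ord0 i - z ord0 i).
  by apply: measurable_funB => //; exact: measurable_rV_coord.
by apply/funext => z; rewrite !mxE.
Qed.

Lemma integral_gauss_conv n s r (v : 'rV[R]_n) : 0 < s -> 0 < r ->
  (\int[@leb R n]_z (gauss_density s (v - z) * gauss_density r z)%:E =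
   (gauss_density (s + r) v)%:E)%E.
Proof.
move=> s0 r0; elim: n v => [|n IH] v.
  by rewrite integral_leb0 ?gauss_density0 ?mulr1//; exact: measurable_gauss_conv.
have sr0 : 0 < s + r by rewrite addr_gt0.
rewrite integral_leb_succ; last 2 first.
- exact: measurable_gauss_conv.
- by move=> x; rewrite lee_fin mulr_ge0 ?gauss_density_ge0.
rewrite (gauss_density_succ _ sr0) EFinM -IH -ge0_integralZr ?lee_fin ?mulr_ge0 ?powR_ge0 ?expR_ge0//; last 2 first.
- exact: measurable_gauss_conv.
- by move=> x _; rewrite lee_fin mulr_ge0 ?gauss_density_ge0.
apply: eq_integral => z _.
have gg0 : 0 <= gauss_density s (rV_tail v - z) * gauss_density r z.
  by apply: mulr_ge0; exact: gauss_density_ge0.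
rewrite -(integral_gauss1_conv (v ord0 ord0) s0 r0) -ge0_integralZl_EFin//; last 2 first.
- by move=> a _; rewrite lee_fin !mulr_ge0 ?powR_ge0 ?expR_ge0.
- apply/measurable_EFinP.
  under eq_fun do rewrite gauss1_mul//.
  apply: measurable_funM => //.
  under eq_fun do rewrite gauss1_normal_pdf ?divr_gt0 ?mulr_gt0//.
  exact: measurable_normal_pdf.
apply: eq_integral => a _; rewrite -EFinM; congr EFin.
rewrite !gauss_density_succ//.
have [-> ->] := rV_consK (z, a : measurableTypeR R).
rewrite [X in gauss_density s X * _](_ : _ = rV_tail v - z); last first.
  by apply/rowP => i; rewrite !mxE liftK.
by rewrite !mxE unlift_none/= mulrACA.
Qed.

End gaussian_kernel.

(** * Densities and independence *)

Section weighted_integral.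
Context d1 d2 (T1 : measurableType d1) (T2 : measurableType d2) {R : realType}.
Variables (mu : {measure set T1 -> \bar R}) (nu : {measure set T2 -> \bar R}).
Variables (Y : T1 -> T2) (g : T1 -> R).
Hypotheses (mY : measurable_fun setT Y) (mg : measurable_fun setT g)
  (g0 : forall x, 0 <= g x).
Hypothesis nuE : forall A, measurable A ->
  (nu A = \int[mu]_x ((\1_A (Y x))%:E * (g x)%:E))%E.

Import HBNNSimple.

(** By [nuE], nu is the image under Y of the measure g.mu; simple functions and monotone convergence
    extend the formula from indicators. It serves with Y = id for densities, and with g a product of
    the other factors for independence. *)
Lemma ge0_integral_weighted (f : T2 -> \bar R) : measurable_fun setT f ->
  (forall y, 0 <= f y)%E -> (\int[nu]_y f y = \int[mu]_x (f (Y x) * (g x)%:E))%E.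
Proof.
move=> mf f0; pose f_ := nnsfun_approx measurableT mf.
have simple (h : {nnsfun T2 >-> R}) :
    (\int[nu]_y (h y)%:E = \int[mu]_x ((h (Y x))%:E * (g x)%:E))%E.
  rewrite integralT_nnsfun sintegralE.
  transitivity (\int[mu]_x (\sum_(k \in range h)
      (k%:E * ((\1_(h @^-1` [set k]) (Y x))%:E * (g x)%:E))))%E; last first.
    apply: eq_integral => x _; rewrite [in RHS](fimfunE h) -fsumEFin//.
    rewrite ge0_mule_fsuml; last first.
      by move=> k; rewrite EFinM; exact: nnfun_muleindic_ge0.
    by apply: eq_fsbigr => k _; rewrite EFinM muleA.
  have mI k : measurable_fun setT (fun x => (\1_(h @^-1` [set k]) (Y x))%:E * (g x)%:E)%E.
    apply/measurable_EFinP; apply: measurable_funM => //.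
    exact: (measurableT_comp (measurable_indic _)).
  have I0 k x : (0 <= (\1_(h @^-1` [set k]) (Y x))%:E * (g x)%:E)%E.
    by rewrite mule_ge0// lee_fin.
  have hk k x : range h k -> (0 <= k%:E * ((\1_(h @^-1` [set k]) (Y x))%:E * (g x)%:E))%E.
    by move=> [y _ <-]; rewrite mule_ge0// lee_fin.
  rewrite ge0_integral_fsum//; last 2 first.
  - by move=> k; exact: measurable_funeM.
  - move=> k x _; have [k0|k0] := leP 0 k; first by rewrite mule_ge0.
    by rewrite preimage_nnfun0//= indic0 mul0e mule0.
  apply: eq_fsbigr => k /set_mem[y _ <-].
  by rewrite ge0_integralZl_EFin// nuE.
transitivity (limn (fun n => \int[nu]_y (f_ n y)%:E)%E).
  rewrite -monotone_convergence//.
  - by apply: eq_integral => y _; apply/esym/cvg_lim => //; exact: cvg_nnsfun_approx.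
  - by move=> n; exact/measurable_EFinP.
  - by move=> n y _; rewrite lee_fin.
  - by move=> y _ m n mn; rewrite lee_fin; exact/lefP/nd_nnsfun_approx.
under eq_fun do rewrite simple.
rewrite -monotone_convergence//.
- apply: eq_integral => x _; apply/cvg_lim => //.
  by apply: cvgeZr => //; exact: cvg_nnsfun_approx.
- move=> n; apply/measurable_EFinP; apply: measurable_funM => //.
  exact: measurableT_comp.
- by move=> n x _; rewrite mule_ge0// lee_fin.
- move=> x _ m n mn; apply: lee_wpmul2r; first by rewrite lee_fin.
  by rewrite lee_fin; exact/lefP/nd_nnsfun_approx.
Qed.

End weighted_integral.

Section density_and_independence.
Context {R : realType} {dO : measure_display} {Omega : measurableType dO}.
Variable P : probability Omega R.

Lemma prob_indicE (A : set Omega) : measurable A ->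
  (P A = \int[P]_w (\1_A w)%:E)%E.
Proof. by move=> mA; rewrite integral_indic// setIT. Qed.

Lemma ge0_integral_density dE (E : measurableType dE)
    (mu : {measure set E -> \bar R}) (Y : Omega -> E) (p : E -> R) (f : E -> \bar R) :
  has_density P mu Y p -> measurable_fun setT Y ->
  measurable_fun setT f -> (forall y, 0 <= f y)%E ->
  (\int[P]_w f (Y w) = \int[mu]_y (f y * (p y)%:E))%E.
Proof.
move=> [mp p0 pE] mY mf f0.
rewrite -[LHS]/(\int[P]_(w in Y @^-1` setT) (f \o Y) w)%E -ge0_integral_pushforward//.
apply: (@ge0_integral_weighted _ _ _ _ _ mu _ id) => //.
move=> A mA; rewrite /= /pushforward pE// integral_mkcond.
apply: eq_integral => x _; rewrite /patch indicE.
by case: ifPn => _; rewrite ?mul1e ?mul0e.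
Qed.

(* The indicators in the product rule are replaced by the functions [f i] one
   index at a time. *)
Lemma integral_prod_independent dE (E : measurableType dE) (n : nat)
    (Y : 'I_n -> Omega -> E) (f : 'I_n -> E -> R) :
  (forall i, measurable_fun setT (Y i)) -> mutually_independent P Y ->
  (forall i, measurable_fun setT (f i)) -> (forall i y, 0 <= f i y <= 1) ->
  (\int[P]_w (\prod_i f i (Y i w))%:E = \prod_i \int[P]_w (f i (Y i w))%:E)%E.
Proof.
move=> mY iY mf f01.
pose F (m : nat) (B : 'I_n -> set E) (i : 'I_n) : E -> R :=
  if (i < m)%N then f i else \1_(B i).
have mF m B i : measurable (B i) -> measurable_fun setT (F m B i).
  by move=> mB; rewrite /F; case: ifP => _ //; exact: measurable_indic.
have F01 m B i y : 0 <= F m B i y <= 1.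
  by rewrite /F; case: ifP => _ //; rewrite indicE; case: (_ \in _); rewrite ?lexx ?ler01.
have F0 m B i y : 0 <= F m B i y by case/andP: (F01 m B i y).
have F1 m B i y : F m B i y <= 1 by case/andP: (F01 m B i y).
suff H m : (m <= n)%N -> forall B : 'I_n -> set E, (forall i, measurable (B i)) ->
  (\int[P]_w (\prod_i F m B i (Y i w))%:E = \prod_i \int[P]_w (F m B i (Y i w))%:E)%E.
  have := H n (leqnn n) (fun=> setT) (fun=> measurableT).
  by rewrite (_ : F n (fun=> setT) = f)//; apply/funext => i; rewrite /F ltn_ord.
elim: m => [_|m IH mn] B mB.
  have F0E i : F 0 B i = \1_(B i) by [].
  transitivity (P (\big[setI/setT]_(i < n) (Y i @^-1` B i))).
    rewrite prob_indicE; last first.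
      apply: bigsetI_measurable => i _.
      by rewrite -[X in measurable X]setTI; exact: mY.
    apply: eq_integral => w _; congr EFin.
    elim/big_ind2 : _ => [|x1 A1 x2 A2 -> ->|i _]; first by rewrite indicT.
      by rewrite indicI.
    by rewrite F0E !indicE.
  rewrite iY//; apply: eq_bigr => i _.
  rewrite prob_indicE//.
  by rewrite -[X in measurable X]setTI; exact: mY.
pose i0 := Ordinal mn.
pose g w := \prod_(i | i != i0) F m B i (Y i w).
have mg : measurable_fun setT g.
  have -> : g = fun w => \prod_i (if i != i0 then F m B i (Y i w) else 1).
    by apply/funext => w; rewrite /g big_mkcond.
  apply: measurable_prod => i _; case: (i != i0) => //.
  by apply: (measurableT_comp (mF _ _ _ _)).
have g0 w : 0 <= g w by apply: prodr_ge0.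
have FS i : i != i0 -> F m.+1 B i = F m B i.
  move=> ii0; rewrite /F ltnS leq_eqVlt; case: eqP => // im.
  by case/eqP: ii0; exact: val_inj.
pose e i := fine (\int[P]_w (F m B i (Y i w))%:E)%E.
have eE i : (\int[P]_w (F m B i (Y i w))%:E)%E = (e i)%:E.
  rewrite fineK// ge0_fin_numE; last by apply: integral_ge0 => w _; rewrite lee_fin.
  apply: (@le_lt_trans _ _ (\int[P]_w 1%:E)%E); last first.
    by rewrite integral_cst//= probability_setT mule1 ltry.
  apply: ge0_le_integral => //; last by move=> w _; rewrite lee_fin.
  - by move=> w _; rewrite lee_fin.
  - by apply/measurable_EFinP; apply: (measurableT_comp (mF _ _ _ _)).
have e0 i : 0 <= e i.
  by rewrite -lee_fin -eE; apply: integral_ge0 => w _; rewrite lee_fin.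
have c0 : 0 <= \prod_(i | i != i0) e i by apply: prodr_ge0.
(* The induction hypothesis, with an arbitrary set A at index m, says that the law of [Y i0] scaled
   by the other means is the law weighted by g. This identity of measures allows the indicator at
   index m to be replaced by [f i0]. *)
have key A : measurable A ->
    (mscale (NngNum c0) (pushforward P (Y i0)) A = \int[P]_w ((\1_A (Y i0 w))%:E * (g w)%:E))%E.
  move=> mA; pose B' i := if i == i0 then A else B i.
  have mB' i : measurable (B' i) by rewrite /B'; case: ifP.
  have F'E i : i != i0 -> F m B' i = F m B i.
    by move=> /negbTE ii0; rewrite /F /B' ii0.
  have F'0 : F m B' i0 = \1_A by rewrite /F /B' eqxx /= ltnn.
  have := IH (ltnW mn) B' mB'; rewrite [in RHS](bigD1 i0)//= F'0.
  under eq_integral do rewrite (bigD1 i0)//= F'0.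
  rewrite (eq_bigr (fun i => (e i)%:E)); last by move=> i ii0; rewrite F'E.
  rewrite prodEFin => h.
  transitivity (\int[P]_w (\1_A (Y i0 w) * \prod_(i | i != i0) F m B' i (Y i w))%:E)%E.
    rewrite h muleC /= /mscale /= /pushforward prob_indicE//.
    by rewrite -[X in measurable X]setTI; exact: mY.
  apply: eq_integral => w _; rewrite -EFinM; congr (_ * _)%:E.
  by apply: eq_bigr => i ii0; rewrite F'E.
have mF0 : measurable_fun setT (fun y => (F m.+1 B i0 y)%:E).
  by apply/measurable_EFinP; exact: mF.
have F00 y : (0 <= (F m.+1 B i0 y)%:E)%E by rewrite lee_fin.
have := ge0_integral_weighted (mY i0) mg g0 (key (mY i0)) mF0 F00.
rewrite ge0_integral_mscale//= ge0_integral_pushforward// => h.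
rewrite (bigD1 i0)//= [X in (_ * X)%E](eq_bigr (fun i => (e i)%:E)); last first.
  by move=> i ii0; rewrite FS.
rewrite prodEFin muleC -[X in (X * _)%E]/((NngNum c0)%:num%:E) h.
apply: eq_integral => w _; rewrite (bigD1 i0)//= -EFinM; congr (_ * _)%:E.
by apply: eq_bigr => i ii0; rewrite FS.
Qed.

End density_and_independence.

(** * Increments of the subordinated Brownian motion *)

Section joint_measurability.
Context {R : realType}.

Lemma measurable_countable_index d1 d2 d3 (T1 : measurableType d1)
    (T2 : measurableType d2) (T3 : measurableType d3) (N : T1 -> nat) (F : nat -> T2 -> T3) :
  (forall k, measurable (N @^-1` [set k])) -> (forall k, measurable_fun setT (F k)) ->
  measurable_fun setT (fun z : T1 * T2 => F (N z.1) z.2).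
Proof.
move=> mN mF _ B mB; rewrite setTI.
rewrite (_ : _ @^-1` B = \bigcup_k ((N @^-1` [set k]) `*` (F k @^-1` B))).
  apply: bigcupT_measurable => k; apply: measurableX => //.
  by rewrite -[X in measurable X]setTI; exact: mF.
apply/seteqP; split => [z Bz|z [k _ [/= <-]]]//.
by exists (N z.1).
Qed.

Lemma measurable_preimage_truncn d1 (T1 : measurableType d1) (s : T1 -> R) (k : nat) :
  measurable_fun setT s -> measurable ((Num.truncn \o s) @^-1` [set k]).
Proof.
move=> ms.
have mI (i : interval R) : measurable (s @^-1` [set` i]).
  by rewrite -[X in measurable X]setTI; apply: ms => //; exact: measurable_itv.
have pos : s @^-1` `[k%:R, k.+1%:R[%classic `<=` (Num.truncn \o s) @^-1` [set k].
  by move=> x /=; rewrite in_itv/= => /truncn_def.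
case: k pos => [|k] pos.
  (* [Num.truncn] sends negative reals to 0, so this level set is unbounded below. *)
  rewrite (_ : _ @^-1` [set 0%N] = s @^-1` `]-oo, 1[%classic); first exact: mI.
  apply/seteqP; split => x /=; rewrite in_itv/=.
    by move=> x0; have := truncnS_gt (s x); rewrite x0.
  move=> x1; apply/truncn0Pn; by rewrite -ltNge.
rewrite (_ : _ @^-1` _ = s @^-1` `[k.+1%:R, k.+2%:R[%classic); first exact: mI.
apply/seteqP; split => // x /= xk; rewrite in_itv/=.
have x0 : 0 <= s x.
  by rewrite leNgt; apply/negP => x0; move: xk; rewrite truncn_floor leNgt x0.
by apply/andP; split; [rewrite -truncn_ge_nat// xk|rewrite -truncn_lt_nat// xk].
Qed.

(** Rounding to countably many values makes a process at a measurable time jointly measurable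
    without regularity in time. The rounded time is nonnegative for every s, so it stays where the
    paths are controlled. *)
Definition grid_below (m : nat) (s : R) : R := (Num.truncn (m.+1%:R * s))%:R / m.+1%:R.

Lemma grid_below_ge0 m s : 0 <= grid_below m s.
Proof. exact: divr_ge0. Qed.

Lemma grid_below_itv m s : 0 <= s -> s - m.+1%:R^-1 <= grid_below m s <= s.
Proof.
move=> s0; have ms0 : 0 <= m.+1%:R * s by rewrite mulr_ge0.
have m0 : 0 < m.+1%:R :> R by [].
have /andP[h1 h2] := truncn_itv ms0; apply/andP; split.
  rewrite ler_pdivlMr// mulrBl mulVf ?gt_eqF// lerBlDr mulrC natr1; exact: ltW.
by rewrite /grid_below ler_pdivrMr// [leRHS]mulrC.
Qed.

Lemma cvg_grid_below s : 0 <= s -> grid_below ^~ s @ \oo --> s.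
Proof.
move=> s0; apply: (@squeeze_cvgr _ _ _ _ (fun m => s - m.+1%:R^-1) (fun=> s)).
- by apply: nearW => m; exact: grid_below_itv.
- rewrite -[X in _ --> X]subr0; apply: cvgB; first exact: cvg_cst.
  exact: cvg_harmonic.
- exact: cvg_cst.
Qed.

(* A version of the process [W], jointly measurable in time and chance, that
   agrees with [W] along continuous paths. *)
Definition path_limit n (Omega : Type) (W : R -> Omega -> 'rV[R]_n) (s : R) (w : Omega) :
    'rV[R]_n :=
  \row_i fine (limn_esup (fun m => (W (grid_below m s) w ord0 i)%:E)).

Lemma path_limitE n (Omega : Type) (W : R -> Omega -> 'rV[R]_n) s w : 0 <= s ->
  {within [set t | 0 <= t], continuous (fun t => W t w)} -> path_limit W s w = W s w.
Proof.
move=> s0 cW; apply/rowP => i; rewrite mxE.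
suff cv : (fun m => (W (grid_below m s) w ord0 i)%:E) @ \oo --> (W s w ord0 i)%:E.
  by rewrite is_cvg_limn_esupE; [rewrite (cvg_lim _ cv)|apply/cvg_ex; eexists; exact: cv].
apply: cvg_EFin; first exact: nearW.
have h : (fun m => W (grid_below m s) w) @ \oo --> W s w.
  have hs : grid_below ^~ s @ \oo --> within [set t | 0 <= t] (nbhs s).
    move=> U sU.
    have H : \forall m \near \oo, (0 <= grid_below m s -> U (grid_below m s)).
      exact: (cvg_grid_below s0 sU).
    suff : \forall m \near \oo, U (grid_below m s) by [].
    by apply: filterS H => m; apply; exact: grid_below_ge0.
  have hW : (fun t => W t w) @ within [set t | 0 <= t] (nbhs s) --> W s w.
    by apply: ((subspace_continuousP _ _).1 cW s).
  exact: (cvg_comp _ (fun t => W t w) hs hW).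
exact: (cvg_comp _ (fun x : 'rV[R]_n => x ord0 i) h (@coord_continuous R 1 n ord0 i (W s w))).
Qed.

Lemma measurable_path_limit n d1 d2 (T1 : measurableType d1) (T2 : measurableType d2)
    (W : R -> T2 -> 'rV[R]_n) (s : T1 -> R) :
  measurable_fun setT s -> (forall t, 0 <= t -> measurable_fun setT (W t)) ->
  measurable_fun setT (fun z : T1 * T2 => path_limit W (s z.1) z.2).
Proof.
move=> ms mW; apply/measurable_fun_rVP => i.
rewrite (_ : (fun _ => _) = fun z => fine (limn_esup (fun m => (W (grid_below m (s z.1)) z.2 ord0 i)%:E))); last first.
  by apply/funext => z; rewrite mxE.
apply: measurableT_comp => //.
apply: measurable_fun_limn_esup => m; apply/measurable_EFinP.
apply: (@measurable_countable_index _ _ _ _ _ _ (fun x => Num.truncn (m.+1%:R * s x))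
  (fun k y => W (k%:R / m.+1%:R) y ord0 i)).
  by move=> k; apply: measurable_preimage_truncn; exact: measurable_funM.
move=> k; apply: (measurableT_comp (measurable_rV_coord i)); apply: mW.
exact: divr_ge0.
Qed.

End joint_measurability.

(** * Joint laws of independent variables *)

Section independent_pairs.
Context {R : realType} {dO : measure_display} {Omega : measurableType dO}.
Variable P : probability Omega R.

Lemma prob_ae_eq (A B : set Omega) : measurable A -> measurable B ->
  {ae P, forall w, A w <-> B w} -> P A = P B.
Proof.
move=> mA mB AB; rewrite !prob_indicE//; apply: ae_eq_integral => //.
- exact/measurable_EFinP/measurable_indic.
- exact/measurable_EFinP/measurable_indic.
apply: filterS AB => w AB _; rewrite !indicE.
by have -> : (w \in A) = (w \in B) by apply/idP/idP; rewrite !inE => /AB.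
Qed.

(* On independent events, the joint law restricted to an event [D] independent of
   the pair stays a product. *)
Lemma joint_law_restr d1 d2 (E1 : measurableType d1) (E2 : measurableType d2)
    (X1 : {mfun Omega >-> E1}) (X2 : {mfun Omega >-> E2}) (D : set Omega) :
  measurable D ->
  (forall A B, measurable A -> measurable B ->
    P (X1 @^-1` A `&` X2 @^-1` B `&` D) = (P (X1 @^-1` A) * P (X2 @^-1` B) * P D)%E) ->
  forall C, measurable C ->
    P ((fun w => (X1 w, X2 w)) @^-1` C `&` D) =
    ((distribution P X1 \x distribution P X2) C * P D)%E.
Proof.
move=> mD iX C mC.
have mX : measurable_fun setT (fun w => (X1 w, X2 w)) by exact: measurable_fun_pair.
pose mu1 := pushforward (mrestr P mD) (fun w => (X1 w, X2 w)).
have [d0 dE] : 0 <= fine (P D) /\ P D = (fine (P D))%:E.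
  by split; [exact: fine_ge0|rewrite fineK// fin_num_measure].
pose nu1 := mscale (NngNum d0) (distribution P X1 \x distribution P X2)%E.
pose G : set (set (E1 * E2)) := [set A `*` B | A in measurable & B in measurable].
transitivity (nu1 C); last by rewrite /nu1 /= /mscale /= dE muleC -dE.
transitivity (mu1 C); first by [].
rewrite /mu1 /nu1; apply: (measure_unique G (fun=> setT)) => //.
- exact: measurable_prod_measurableType.
- move=> _ _ [A1 mA1 [A2 mA2 <-]] [B1 mB1 [B2 mB2 <-]].
  exists (A1 `&` B1); first exact: measurableI.
  by exists (A2 `&` B2); [exact: measurableI|rewrite setXI].
- by move=> _; exists setT => //; exists setT => //; rewrite setXTT.
- by rewrite bigcup_const//; exists 0%N.
- move=> _ [A mA [B mB <-]].
  rewrite /nu1 /= /mscale /= product_measure1E// muleC -dE.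
  exact: iX.
- move=> _; rewrite /mu1 /= /pushforward /= /mrestr.
  apply: (le_lt_trans _ (ltry 1)); apply: probability_le1.
  by rewrite preimage_setT setTI.
Qed.

Lemma joint_law d1 d2 (E1 : measurableType d1) (E2 : measurableType d2)
    (X1 : {mfun Omega >-> E1}) (X2 : {mfun Omega >-> E2}) :
  (forall A B, measurable A -> measurable B ->
    P (X1 @^-1` A `&` X2 @^-1` B) = (P (X1 @^-1` A) * P (X2 @^-1` B))%E) ->
  forall C, measurable C ->
    P ((fun w => (X1 w, X2 w)) @^-1` C) = (distribution P X1 \x distribution P X2)%E C.
Proof.
move=> iX C mC; have := @joint_law_restr _ _ _ _ X1 X2 setT measurableT _ C mC.
rewrite setIT probability_setT mule1; apply => A B mA mB.
by rewrite setIT mule1; exact: iX.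
Qed.

End independent_pairs.

Section independent_paths.
Context {R : realType} {dO : measure_display} {Omega : measurableType dO}.
Variable P : probability Omega R.

Definition process_events dE (E : measurableType dE) (X : R -> Omega -> E) : set (set Omega) :=
  [set A | exists t B, [/\ 0 <= t, measurable B & A = X t @^-1` B]].

Lemma process_sigma_measurable dE (E : measurableType dE) (X : R -> Omega -> E) A :
  (forall t, measurable_fun setT (X t)) -> process_sigma X A -> measurable A.
Proof.
move=> mX; apply: smallest_sub; first exact: sigma_algebra_measurable.
by move=> _ [t [B [_ mB ->]]]; rewrite -[X in measurable X]setTI; exact: mX.
Qed.

Lemma measurable_process_sigma dE (E : measurableType dE) (X : R -> Omega -> E) t :
  0 <= t ->
  measurable_fun setT (X t : g_sigma_algebraType (process_events X) -> E).
Proof.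
move=> t0 _ B mB; rewrite setTI; apply: sub_sigma_algebra.
by exists t, B.
Qed.

(* [C] is measurable for the sigma-algebras generated by the two processes, hence
   their common sample point may be split into two independent ones. *)
Lemma independent_processes_diag dE dF (E : measurableType dE) (F : measurableType dF)
    (X : R -> Omega -> E) (Y : R -> Omega -> F)
    (C : set (g_sigma_algebraType (process_events X) * g_sigma_algebraType (process_events Y))) :
  (forall t, measurable_fun setT (X t)) -> (forall t, measurable_fun setT (Y t)) ->
  independent_processes P Y X -> measurable C ->
  [/\ measurable [set w : Omega | C (w, w)],
     forall v, measurable [set w : Omega | C (v, w)],
     measurable_fun setT (fun v : Omega => P [set w | C (v, w)]) &
     P [set w | C (w, w)] = (\int[P]_v P [set w | C (v, w)])%E].
Proof.
move=> mX mY iXY mC.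
(* The identity, with a generated sigma-algebra on the target, is a random variable carrying the
   whole process. Independence of the two processes becomes independence of two such variables, and
   [joint_law] applies. *)
have midX : measurable_fun setT (id : Omega -> g_sigma_algebraType (process_events X)).
  by move=> _ A mA; rewrite setTI; exact: (process_sigma_measurable mX).
have midY : measurable_fun setT (id : Omega -> g_sigma_algebraType (process_events Y)).
  by move=> _ A mA; rewrite setTI; exact: (process_sigma_measurable mY).
pose iX : {mfun Omega >-> g_sigma_algebraType (process_events X)} :=
  HB.pack (id : Omega -> g_sigma_algebraType (process_events X)) (isMeasurableFun.Build _ _ _ _ _ midX).
pose iY : {mfun Omega >-> g_sigma_algebraType (process_events Y)} :=
  HB.pack (id : Omega -> g_sigma_algebraType (process_events Y)) (isMeasurableFun.Build _ _ _ _ _ midY).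
have secE v : [set w : Omega | C (v, w)] = xsection C v.
  by apply/seteqP; split => w /=; rewrite /xsection/= inE.
have mmass : measurable_fun setT (fun v : g_sigma_algebraType (process_events X) =>
    (distribution P iY \o xsection C) v) by exact: measurable_fun_xsection.
split.
- rewrite (_ : [set w : Omega | _] = (fun w : Omega => (iX w, iY w)) @^-1` C)//.
  rewrite -[X in measurable X]setTI.
  have mp : measurable_fun setT (fun w : Omega => (iX w, iY w)).
    exact: measurable_fun_pair.
  exact: mp.
- move=> v; rewrite secE; apply: (process_sigma_measurable mY).
  by have := measurable_xsection v mC.
- rewrite (_ : (fun _ => _) = (distribution P iY \o xsection C) \o iX).
    exact: measurableT_comp.
  by apply/funext => v; rewrite secE.
have := @joint_law _ _ _ P _ _ _ _ iX iY _ C mC.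
rewrite /= => ->; last first.
  move=> A B mA mB; rewrite setIC muleC; exact: iXY.
rewrite /product_measure1 ge0_integral_distribution//.
by apply: eq_integral => v _ /=; rewrite secE.
Qed.

End independent_paths.

Lemma bigsetI_ordP (T : Type) (k : nat) (D : 'I_k -> set T) x :
  (\big[setI/setT]_(i < k) D i) x <-> forall i, D i x.
Proof.
rewrite -(bigcap_seq (index_enum _) D); split => [h i|h i _]; last exact: h.
by apply: h; rewrite /= mem_index_enum.
Qed.

Section subordinated_increments.
Context {R : realType} {dO : measure_display} {Omega : measurableType dO}.
Variable P : probability Omega R.

Lemma ae_prob0 (A : set Omega) : measurable A -> P A = 0%E -> {ae P, forall w, ~ A w}.
Proof. by move=> mA A0; exists A; split => // w /= /contrapT. Qed.

Lemma prob0_ae (A : set Omega) : measurable A -> {ae P, forall w, ~ A w} -> P A = 0%E.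
Proof.
move=> mA [N [mN N0 AN]]; apply/eqP; rewrite eq_le measure_ge0 andbT -N0.
by apply: le_measure; rewrite ?inE// => w Aw; apply: AN => /(_ Aw).
Qed.

Definition gauss_mass n (B : set 'rV[R]_n) (s : R) : \bar R :=
  (\int[@leb R n]_(y in B) (gauss_density s y)%:E)%E.

Lemma gauss_massE n (B : set 'rV[R]_n) s :
  gauss_mass B s = (\int[@leb R n]_y ((gauss_density s y)%:E * (\1_B y)%:E))%E.
Proof.
rewrite /gauss_mass integral_mkcond; apply: eq_integral => y _.
by rewrite /patch indicE; case: ifPn => _; rewrite ?mule1 ?mule0.
Qed.

Lemma gauss_mass_ge0 n (B : set 'rV[R]_n) s : (0 <= gauss_mass B s)%E.
Proof. by apply: integral_ge0 => y _; rewrite lee_fin gauss_density_ge0. Qed.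

Lemma measurable_gauss_mass n (B : set 'rV[R]_n) : measurable B ->
  measurable_fun setT (gauss_mass B).
Proof.
move=> mB.
rewrite (_ : gauss_mass B = fubini_F (@leb R n)
    (fun z : R * 'rV[R]_n => ((gauss_density z.1 z.2)%:E * (\1_B z.2)%:E)%E)).
  apply: measurable_fun_fubini_tonelli_F => [|z].
    apply: emeasurable_funM; apply/measurable_EFinP.
      exact: measurable_gauss_density.
    exact: (measurableT_comp (measurable_indic _)).
  by rewrite mule_ge0 ?lee_fin ?gauss_density_ge0.
by apply/funext => s; rewrite gauss_massE.
Qed.

Variables (n : nat) (W : R -> {RV P >-> 'rV[R]_n}) (S : R -> {RV P >-> R}) (beta : R).
Hypotheses (hW : brownian_motion W) (hS : stable_subordinator beta S)
  (hWS : independent_processes P W S)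
  (Spos : forall t, 0 < t -> {ae P, forall w, 0 < S t w}).

(** The normalisation is read off the Brownian motion: this is the probability that W_s - W_0 lies
    in B. *)
Lemma gauss_mass_le1 (B : set 'rV[R]_n) s : measurable B -> 0 < s -> (gauss_mass B s <= 1)%E.
Proof.
move=> mB s0; have [_ _ dW _] := hW.
have [_ _ hs] := dW 0 s (lexx _) s0; rewrite subr0 in hs.
rewrite /gauss_mass -[X in (X <= _)%E]hs//; apply: probability_le1.
rewrite -[X in measurable X]setTI.
have mD : measurable_fun setT (fun w => W s w - W 0 w).
  apply/measurable_fun_rVP => i.
  rewrite (_ : (fun _ => _) = fun w => W s w ord0 i - W 0 w ord0 i).
    by apply: measurable_funB; apply: (measurableT_comp (measurable_rV_coord _)).
  by apply/funext => w; rewrite !mxE.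
exact: mD.
Qed.

Lemma increment_law s t (B : set R) : 0 <= s -> s <= t -> measurable B ->
  P ((fun w => S t w - S s w) @^-1` B) = P (S (t - s) @^-1` B).
Proof.
move=> s0 st mB; have [[_ _ h _] _ _ _] := hS.
by have := h s (t - s) s0; rewrite subr_ge0 st => /(_ isT B mB); rewrite subrKC.
Qed.

Lemma increment_gt0 s t : 0 <= s -> s < t -> {ae P, forall w, 0 < S t w - S s w}.
Proof.
move=> s0 st.
have mD : measurable_fun setT (fun w => S t w - S s w) by exact: measurable_funB.
have mI : measurable `]-oo, (0:R)]%classic by exact: measurable_itv.
have : {ae P, forall w, ~ ((fun w => S t w - S s w) @^-1` `]-oo, 0]%classic) w}.
  apply: ae_prob0; first by rewrite -[X in measurable X]setTI; exact: mD.
  rewrite increment_law//; last exact: ltW.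
  apply: prob0_ae; first by rewrite -[X in measurable X]setTI; exact: measurable_funP.
  apply: filterS (Spos (t := t - s) _); last by rewrite subr_gt0.
  by move=> w w0 /=; rewrite in_itv/= leNgt w0.
by apply: filterS => w /=; rewrite in_itv/= => /negP; rewrite -ltNge.
Qed.

Lemma integral_increment s t (f : R -> \bar R) : 0 <= s -> s <= t ->
  measurable_fun setT f -> (forall y, 0 <= f y)%E ->
  (\int[P]_w f (S t w - S s w)%R = \int[P]_w f (S (t - s) w)%R)%E.
Proof.
move=> s0 st mf f0.
have mD : measurable_fun setT (fun w => S t w - S s w) by exact: measurable_funB.
transitivity (\int[pushforward P (fun w => S t w - S s w)%R]_y f y)%E.
  by rewrite ge0_integral_pushforward.
transitivity (\int[pushforward P (S (t - s)%R)]_y f y)%E.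
  by apply: eq_measure_integral => // A mA _; exact: increment_law.
by rewrite ge0_integral_pushforward.
Qed.

(** Once the path of [S] is frozen, the increments of [W] are taken at deterministic times, hence
    independent and Gaussian; the variances are the increments of [S], themselves independent. The
    [Z i] are measurable variables equal almost surely to the increments at random times, whose own
    measurability is not given. *)
Lemma subordinated_increments_law (k : nat) (t : nat -> R)
    (Z : nat -> Omega -> 'rV[R]_n) (B : nat -> set 'rV[R]_n) :
  0 <= t 0%N -> (forall i, t i <= t i.+1) -> (forall i, (i < k)%N -> t i < t i.+1) ->
  (forall i, measurable_fun setT (Z i)) ->
  (forall i, (i < k)%N ->
    {ae P, forall w, Z i w = W (S (t i.+1) w) w - W (S (t i) w) w}) ->
  (forall i, measurable (B i)) ->
  P (\big[setI/setT]_(i < k) (Z i @^-1` B i)) =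
  (\prod_(i < k) \int[P]_w gauss_mass (B i) (S (t i.+1 - t i)%R w))%E.
Proof.
move=> t0 tS tk mZ ZE mB.
have tge i : 0 <= t i by elim: i => // i; move/le_trans; apply.
(* The first sample point drives [S], the second drives [W]; on the diagonal [H i] is almost surely
   [Z i]. *)
pose H i (z : g_sigma_algebraType (process_events S) * g_sigma_algebraType (process_events W)) :=
  path_limit W (S (t i.+1) z.1) z.2 - path_limit W (S (t i) z.1) z.2.
pose C := \big[setI/setT]_(i < k) (H i @^-1` B i).
have mH i : measurable_fun setT (H i).
  have mp j := measurable_path_limit (measurable_process_sigma (tge j))
    (fun r r0 => measurable_process_sigma (X := W) r0).
  apply/measurable_fun_rVP => l.
  rewrite (_ : (fun _ => _) = fun z => path_limit W (S (t i.+1) z.1) z.2 ord0 l -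
      path_limit W (S (t i) z.1) z.2 ord0 l).
    apply: measurable_funB.
      by apply: (measurableT_comp (measurable_rV_coord l)); exact: mp.
    by apply: (measurableT_comp (measurable_rV_coord l)); exact: mp.
  by apply/funext => z; rewrite !mxE.
have mC : measurable C.
  apply: bigsetI_measurable => i _.
  by rewrite -[X in measurable X]setTI; exact: mH.
have [_ indW densW contW] := hW.
have [[_ indS _ _] posS _ _] := hS.
have mW s : measurable_fun setT (W s) by exact: measurable_funP.
have mS s : measurable_fun setT (S s) by exact: measurable_funP.
have CE v w : C (v, w) <-> forall i : 'I_k, B i (H i (v, w)).
  by rewrite /C bigsetI_ordP.
have [mdiag msec mmass Ediag] := independent_processes_diag mS mW hWS mC.
have aeZ : {ae P, forall w, forall i, (i < k)%N -> Z i w = W (S (t i.+1) w) w - W (S (t i) w) w}.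
  apply: ae_foralln => i; have [ik|ik] := ltnP i k; last by apply: nearW.
  by apply: filterS (ZE i ik) => w.
rewrite (_ : P _ = P [set w | C (w, w)]); last first.
  apply: prob_ae_eq => //.
    apply: bigsetI_measurable => i _.
    by rewrite -[X in measurable X]setTI; exact: mZ.
  apply: filterS3 aeZ contW posS => w Zw cw Sw /=.
  rewrite bigsetI_ordP CE.
  have HE (i : 'I_k) : H i (w, w) = Z i w.
    by rewrite /H /= !path_limitE ?Zw// Sw.
  by split => h i; have := h i; rewrite /= HE.
rewrite Ediag.
(* Cutting at s > 0 gives a real function with values in [0, 1] everywhere, as
   [integral_prod_independent] requires; increments of [S] are almost surely positive, so nothing is
   lost. *)
pose F i s := \1_(`]0, +oo[%classic) s * fine (gauss_mass (B i) s) : R.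
have FE i s : 0 < s -> (F i s)%:E = gauss_mass (B i) s.
  move=> s0; rewrite /F indicE (_ : (s \in _) = true); last by apply: mem_set; rewrite /= in_itv/= s0.
  rewrite mul1r fineK//.
  rewrite ge0_fin_numE ?gauss_mass_ge0//.
  by apply: le_lt_trans (ltry 1); apply: gauss_mass_le1.
have F01 i s : 0 <= F i s <= 1.
  have [s0|s0] := ltP 0 s; first by rewrite -!lee_fin FE// gauss_mass_ge0 gauss_mass_le1.
  rewrite /F indicE (_ : (s \in _) = false) ?mul0r ?lexx ?ler01//.
  by apply: memNset; rewrite /= in_itv/= andbT; apply/negP; rewrite -leNgt.
have mF i : measurable_fun setT (F i).
  apply: measurable_funM; first exact: measurable_indic.
  by apply: measurableT_comp => //; exact: measurable_gauss_mass.
have mI (i : 'I_k) : measurable_fun setT (fun w => S (t i.+1) w - S (t i) w).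
  exact: measurable_funB.
have [_ _ incS _] := hS.
have aeS : {ae P, forall v, forall i, (i < k)%N -> 0 < S (t i.+1) v - S (t i) v}.
  apply: ae_foralln => i; have [ik|ik] := ltnP i k; last by apply: nearW.
  by apply: filterS (increment_gt0 (tge i) (tk i ik)) => v.
transitivity (\int[P]_v (\prod_(i < k) F i (S (t i.+1) v - S (t i) v))%:E)%E.
  apply: ae_eq_integral => //.
    apply/measurable_EFinP; apply: measurable_prod => i _.
    exact: (measurableT_comp (mF i) (mI i)).
  apply: filterS3 aeS posS incS => v Sv0 Spos' Sinc _.
  have s0 : 0 <= S (t 0%N) v by exact: Spos'.
  have sS i : S (t i) v <= S (t i.+1) v by exact: Sinc.
  have mD (i : 'I_k) : measurable ((fun w => W (S (t i.+1) v) w - W (S (t i) v) w) @^-1` B i).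
    rewrite -[X in measurable X]setTI.
    have mW' : measurable_fun setT (fun w => W (S (t i.+1) v) w - W (S (t i) v) w).
      apply/measurable_fun_rVP => l.
      rewrite (_ : (fun _ => _) = fun w => W (S (t i.+1) v) w ord0 l - W (S (t i) v) w ord0 l).
        by apply: measurable_funB; apply: (measurableT_comp (measurable_rV_coord _)).
      by apply/funext => w; rewrite !mxE.
    exact: mW'.
  (* With v fixed, the section of C is an event on increments of [W] along the nondecreasing
     deterministic times [S (t i) v]. *)
  transitivity (P (\big[setI/setT]_(i < k) ((fun w => W (S (t i.+1) v) w - W (S (t i) v) w) @^-1` B i))).
    apply: prob_ae_eq => //; first exact: bigsetI_measurable.
    apply: filterS contW => w cw; rewrite bigsetI_ordP /= CE.
    have HE (i : 'I_k) : H i (v, w) = W (S (t i.+1) v) w - W (S (t i) v) w.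
      by rewrite /H /= !path_limitE// Spos'.
    by split => h i; have := h i; rewrite /= HE.
  rewrite (indW k (fun i => S (t i) v) s0 sS)//.
  rewrite -prodEFin; apply: eq_bigr => i _.
  rewrite FE ?Sv0//.
  have lt_s : S (t i) v < S (t i.+1) v by rewrite -subr_gt0 Sv0.
  have [_ _ ->//] := densW (S (t i) v) (S (t i.+1) v) (Spos' _ (tge i)) lt_s.
rewrite (@integral_prod_independent _ _ _ P _ _ k (fun i w => S (t i.+1) w - S (t i) w) F)//; last exact: indS.
apply: eq_bigr => i _.
rewrite (integral_increment (f := EFin \o F i) (tge i) (tS i))//; last 2 first.
- exact/measurable_EFinP.
- by move=> y; rewrite lee_fin; case/andP: (F01 i y).
apply: ae_eq_integral => //.
- by apply/measurable_EFinP; exact: (measurableT_comp (mF i) (mS _)).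
- by apply: (measurableT_comp (measurable_gauss_mass _)).
apply: filterS (Spos (t := t i.+1 - t i) _) => [w w0 _|]; last by rewrite subr_gt0 tk.
exact: FE.
Qed.

End subordinated_increments.

(** * The subordinated Gaussian kernel *)

Section euclidean_norm.
Context {R : realType}.

Lemma sum_mul_le_enorm n (x y : 'rV[R]_n) :
  \sum_(i < n) x ord0 i * y ord0 i <= enorm x * enorm y.
Proof.
set A := enorm x; set B := enorm y.
have A0 : 0 <= A by exact: enorm_ge0.
have B0 : 0 <= B by exact: enorm_ge0.
have zero (u v : 'rV[R]_n) : enorm u = 0 -> \sum_(i < n) u ord0 i * v ord0 i = 0.
  move=> u0; apply: big1 => i _.
  have : \sum_(i < n) u ord0 i ^+ 2 == 0 by rewrite -enorm_sqr u0 expr0n.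
  rewrite psumr_eq0; last by move=> j _; exact: sqr_ge0.
  by move=> /allP /(_ i (mem_index_enum _)); rewrite sqrf_eq0 => /eqP ->; rewrite mul0r.
have [A00|A00] := eqVneq A 0; first by rewrite zero// A00 mul0r.
have [B00|B00] := eqVneq B 0.
  under eq_bigr do rewrite mulrC.
  by rewrite zero// B00 mulr0.
have AB : 0 < A * B by rewrite mulr_gt0// lt0r ?A00 ?B00.
have : 0 <= \sum_(i < n) (B * x ord0 i - A * y ord0 i) ^+ 2.
  by apply: sumr_ge0 => i _; exact: sqr_ge0.
have -> : \sum_(i < n) (B * x ord0 i - A * y ord0 i) ^+ 2 =
    2 * (A * B) * (A * B - \sum_(i < n) x ord0 i * y ord0 i).
  transitivity (B ^+ 2 * (\sum_(i < n) x ord0 i ^+ 2) + A ^+ 2 * (\sum_(i < n) y ord0 i ^+ 2)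
     - 2 * (A * B) * \sum_(i < n) x ord0 i * y ord0 i).
    rewrite !mulr_sumr -big_split/= -sumrB; apply: eq_bigr => i _; ring.
  rewrite -!enorm_sqr -/A -/B; ring.
by rewrite pmulr_rge0 ?subr_ge0// mulr_gt0.
Qed.

Lemma enormD n (x y : 'rV[R]_n) : enorm (x + y) <= enorm x + enorm y.
Proof.
rewrite -(@ler_pXn2r _ 2)// ?nnegrE ?addr_ge0 ?enorm_ge0//.
rewrite sqrrD !enorm_sqr.
have -> : \sum_(i < n) (x + y) ord0 i ^+ 2 = \sum_(i < n) x ord0 i ^+ 2 +
    (\sum_(i < n) x ord0 i * y ord0 i) *+ 2 + \sum_(i < n) y ord0 i ^+ 2.
  rewrite -sumrMnl -!big_split/=; apply: eq_bigr => i _.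
  by rewrite mxE sqrrD.
have := sum_mul_le_enorm x y; lra.
Qed.

Lemma enormN n (x : 'rV[R]_n) : enorm (- x) = enorm x.
Proof. by congr Num.sqrt; apply: eq_bigr => i _; rewrite mxE sqrrN. Qed.

Lemma enormZ n (a : R) (x : 'rV[R]_n) : 0 <= a -> enorm (a *: x) = a * enorm x.
Proof.
move=> a0; rewrite /enorm -[in RHS](ger0_norm a0) -sqrtr_sqr -sqrtrM ?sqr_ge0//.
by congr Num.sqrt; rewrite mulr_sumr; apply: eq_bigr => i _; rewrite mxE exprMn.
Qed.

Lemma enorm_le_coord n (x : 'rV[R]_n) (e : R) : 0 <= e ->
  (forall i, `|x ord0 i| <= e) -> enorm x <= n%:R * e.
Proof.
move=> e0 xe; rewrite -(@ler_pXn2r _ 2)// ?nnegrE ?mulr_ge0 ?enorm_ge0// enorm_sqr.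
apply: (@le_trans _ _ (\sum_(i < n) e ^+ 2)).
  by apply: ler_sum => i _; rewrite -real_normK ?num_real// lerXn2r ?nnegrE.
rewrite sumr_const card_ord -[leLHS]mulr_natl exprMn ler_wpM2r ?sqr_ge0//.
by rewrite -natrX ler_nat; case: (n) => // m; rewrite leq_pmull.
Qed.

End euclidean_norm.

Section subordinated_density.
Context {R : realType} {dO : measure_display} {Omega : measurableType dO}.
Variables (P : probability Omega R) (n : nat) (S : R -> {RV P >-> R}) (beta : R).
Hypotheses (hbeta : 1 / 2 < beta < 1) (hS : stable_subordinator beta S)
  (Spos : forall t, 0 < t -> {ae P, forall w, 0 < S t w}).

Definition sub_density (t : R) (y : 'rV[R]_n) : R :=
  fine (\int[P]_w (gauss_density (S t w) y)%:E)%E.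

(** The moment bounds ask for positivity at every sample point, while [S t] is positive only almost
    surely. *)
Let S' t w := if 0 < S t w then S t w else 1.

Let S'_gt0 t w : 0 < S' t w.
Proof. by rewrite /S'; case: ifP. Qed.

Let measurable_S' t : measurable_fun setT (S' t).
Proof.
apply: measurable_fun_ifT => //; apply: measurable_fun_ltr => //.
Qed.

Let integral_S' t (f : R -> \bar R) : 0 < t -> measurable_fun setT f ->
  (\int[P]_w f (S t w) = \int[P]_w f (S' t w))%E.
Proof.
move=> t0 mf; apply: ae_eq_integral => //.
- exact: (measurableT_comp mf).
- exact: (measurableT_comp mf).
- by apply: filterS (Spos t0) => w w0 _; rewrite /S' w0.
Qed.

Let laplace_S' t : 0 < t -> stable_laplace P beta t (S' t).
Proof.
move=> t0 g g0; have [_ _ _ /(_ g t g0 (ltW t0))] := hS.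
rewrite unlock => <-; apply/esym.
rewrite (integral_S' (f := fun s => (expR (- (g * s)))%:E))//.
by apply/measurable_EFinP; apply: measurableT_comp => //; apply: measurableT_comp => //.
Qed.

Let measurable_gauss_time (y : 'rV[R]_n) :
  measurable_fun setT (fun s : R => (gauss_density s y)%:E).
Proof. by apply/measurable_EFinP; exact: measurable_gauss_density. Qed.

Let gauss_phi t (y : 'rV[R]_n) : 0 < t ->
  (\int[P]_w (gauss_density (S t w) y)%:E =
   ((2 * pi) `^ (- (n%:R / 2)))%:E * stable_phi P (n%:R / 2) (S' t) (enorm y ^+ 2))%E.
Proof.
move=> t0; rewrite (integral_S' (f := fun s => (gauss_density s y)%:E))//.
rewrite -ge0_integralZl_EFin ?powR_ge0//; last 2 first.
- by move=> w _; rewrite lee_fin mulr_ge0 ?powR_ge0 ?expR_ge0.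
- by apply/measurable_EFinP; exact: measurable_powR_expR.
apply: eq_integral => w _; rewrite -EFinM /gauss_density powRM ?mulr_ge0 ?pi_ge0 ?(ltW (S'_gt0 _ _))//.
by rewrite mulrA.
Qed.

Let n2 : 0 <= n%:R / 2 :> R. Proof. by rewrite divr_ge0. Qed.

(** The integral is finite, even at y = 0, by the upper bound [stable_phi_le], so [fine] loses
    nothing. *)
Lemma sub_densityE t (y : 'rV[R]_n) : 0 < t ->
  (\int[P]_w (gauss_density (S t w) y)%:E = (sub_density t y)%:E)%E.
Proof.
move=> t0; rewrite /sub_density fineK// ge0_fin_numE; last first.
  by apply: integral_ge0 => w _; rewrite lee_fin gauss_density_ge0.
rewrite gauss_phi//; have [C C0 HC] := stable_phi_le P hbeta n2.
apply: lte_mul_pinfty; rewrite ?lee_fin ?powR_ge0//.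
by apply: le_lt_trans (HC t _ _ (measurable_S' t) (S'_gt0 t) t0 (laplace_S' t0) (sqr_ge0 _)) (ltry _).
Qed.

Lemma sub_density_ge0 t (y : 'rV[R]_n) : 0 <= sub_density t y.
Proof.
by apply: fine_ge0; apply: integral_ge0 => w _; rewrite lee_fin gauss_density_ge0.
Qed.

Lemma measurable_sub_density t : measurable_fun setT (sub_density t).
Proof.
apply: measurableT_comp => //.
apply: (measurable_fun_fubini_tonelli_F (m2 := P)
  (fun z : 'rV[R]_n * Omega => (gauss_density (S t z.2) z.1)%:E)) => [|z].
  apply/measurable_EFinP; apply: measurable_gauss_density => //.
  exact: (measurableT_comp (measurable_funP (S t))).
by rewrite lee_fin gauss_density_ge0.
Qed.

Lemma p_alphaE eta t (y : 'rV[R]_n) : 0 < t -> has_density P lebesgue_measure (S t) (eta t) ->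
  p_alpha eta t y = (sub_density t y)%:E.
Proof.
move=> t0 hd; rewrite -sub_densityE//.
pose f (s : R) : \bar R := ((gauss_density s y)%:E * (\1_(`]0, +oo[%classic) s)%:E)%E.
have mf : measurable_fun setT f.
  by apply: emeasurable_funM => //; exact/measurable_EFinP/measurable_indic.
transitivity (\int[P]_w f (S t w))%E.
  rewrite (ge0_integral_density hd (measurable_funP (S t)) mf); last first.
    by move=> s; rewrite mule_ge0 ?lee_fin ?gauss_density_ge0.
  rewrite /p_alpha [LHS]integral_mkcond; apply: eq_integral => s _.
  rewrite /patch /f indicE; case: ifPn => _; first by rewrite mule1 EFinM.
  by rewrite mule0 mul0e.
apply: ae_eq_integral => //.
- exact: (measurableT_comp mf).
- exact: (measurableT_comp (measurable_gauss_time y)).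
- apply: filterS (Spos t0) => w w0 _; rewrite /f indicE.
  by rewrite (_ : (S t w \in _) = true) ?mule1//; apply: mem_set; rewrite /= in_itv/= w0.
Qed.

Lemma sub_density_harnack (K : R) : 0 <= K -> exists2 C : R, 0 < C &
  forall t (y v : 'rV[R]_n), 0 < t -> enorm v <= K * t `^ (2 * beta)^-1 ->
  sub_density t (y - v) <= (1 + C * (enorm v * t `^ (- (2 * beta)^-1))) * sub_density t y.
Proof.
move=> K0; have [C C0 HC] := stable_phi_harnack P hbeta n2 K0; exists C => // t y v t0 vK.
rewrite -lee_fin EFinM -(sub_densityE (y - v) t0) -(sub_densityE y t0).
rewrite (gauss_phi (y - v) t0) (gauss_phi y t0) muleCA lee_wpmul2l ?lee_fin ?powR_ge0//.
apply: HC => //; rewrite ?enorm_ge0 ?vK//.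
- exact: laplace_S'.
- by rewrite -{1}(subrK v y) enormD.
Qed.

Lemma integral_subordinatorD s t (f : R -> \bar R) : 0 <= s -> 0 <= t ->
  measurable_fun setT f -> (forall y, 0 <= f y)%E ->
  (\int[P]_w f (S (s + t)%R w) = \int[P]_v \int[P]_w f (S s v + S t w)%R)%E.
Proof.
move=> s0 t0 mf f0; have [[S0 indS statS _] _ _ _] := hS.
(* The two increments along 0, s, s + t are independent, and the second has the law of [S t] by
   stationarity. *)
pose T i := if i is 0 then 0 else if i is 1 then s else s + t.
have T0 : 0 <= T 0%N by [].
have TS i : T i <= T i.+1 by case: i => [|[|i]] //=; rewrite lerDl.
have mD i : measurable_fun setT (fun w => S (T i.+1) w - S (T i) w) by exact: measurable_funB.
pose X i : {mfun Omega >-> R} :=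
  HB.pack (fun w => S (T i.+1) w - S (T i) w) (isMeasurableFun.Build _ _ _ _ _ (mD i)).
have iX A B : measurable A -> measurable B ->
    P (X 0%N @^-1` A `&` X 1%N @^-1` B) = (P (X 0%N @^-1` A) * P (X 1%N @^-1` B))%E.
  move=> mA mB; have := indS 2%N T T0 TS (fun i => if i == 0 :> nat then A else B).
  rewrite !big_ord_recl !big_ord0 setIT mule1; apply => i.
  by case: ifP.
transitivity (\int[P]_w f (X 0%N w + X 1%N w)%R)%E.
  apply: ae_eq_integral => //.
  - exact: (measurableT_comp mf).
  - by apply: (measurableT_comp mf); exact: measurable_funD.
  - apply: filterS S0 => w w0 _; rewrite /X /= w0 subr0; congr f; ring.
have mX : measurable_fun setT (fun w => (X 0%N w, X 1%N w)) by exact: measurable_fun_pair.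
have mf2 : measurable_fun setT (fun z : R * R => f (z.1 + z.2)).
  by apply: (measurableT_comp mf); exact: measurable_funD.
transitivity (\int[pushforward P (fun w => (X 0%N w, X 1%N w))]_z f (z.1 + z.2)%R)%E.
  by rewrite ge0_integral_pushforward.
rewrite (eq_measure_integral (distribution P (X 0%N) \x distribution P (X 1%N))%E); last first.
  by move=> C mC _; exact: joint_law.
rewrite fubini_tonelli1//.
have e0 : {ae P, forall w, X 0%N w = S s w}.
  by apply: filterS S0 => w w0; rewrite /X /= w0 subr0.
rewrite ge0_integral_distribution//; last 2 first.
- by apply: (measurable_fun_fubini_tonelli_F (fun z : R * R => f (z.1 + z.2))).
- by move=> y; apply: integral_ge0.
have law2 v : (fubini_F (distribution P (X 1%N)) (fun z : R * R => f (z.1 + z.2)%R) v =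
    \int[P]_w f (v + S t w)%R)%E.
  rewrite /fubini_F /= ge0_integral_distribution//; last first.
    by apply: (measurableT_comp mf); exact: measurable_funD.
  rewrite /= (integral_increment hS (f := fun r => f (v + r)))//; last 2 first.
  - by rewrite lerDl.
  - by apply: (measurableT_comp mf); exact: measurable_funD.
  by rewrite addrAC subrr add0r.
apply: ae_eq_integral => //.
- apply: measurableT_comp => //.
  by apply: (measurable_fun_fubini_tonelli_F (fun z : R * R => f (z.1 + z.2))).
- apply: (measurable_fun_fubini_tonelli_F (m2 := P) (fun z => f (S s z.1 + S t z.2))) => // .
  apply: (measurableT_comp mf); apply: measurable_funD.
    exact: (measurableT_comp (measurable_funP (S s))).
  exact: (measurableT_comp (measurable_funP (S t))).
- by apply: filterS e0 => v ve _; rewrite -ve; exact: law2.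
Qed.

(** Fubini brings the space integral inside, where Gaussian convolution adds the variances. What
    remains is the mean over two independent copies of the subordinator, whose sum has the law of
    [S (s + t)]. *)
Lemma integral_sub_density_conv s t (v : 'rV[R]_n) : 0 < s -> 0 < t ->
  (\int[@leb R n]_z ((sub_density s (v - z))%:E * (sub_density t z)%:E) =
   (sub_density (s + t) v)%:E)%E.
Proof.
move=> s0 t0.
have g0 r (x : 'rV[R]_n) : 0 <= gauss_density r x by exact: gauss_density_ge0.
have mvz : measurable_fun setT (fun z : 'rV[R]_n => v - z).
  apply/measurable_fun_rVP => i.
  rewrite (_ : (fun _ => _) = fun z : 'rV[R]_n => v ord0 i - z ord0 i).
    by apply: measurable_funB => //; exact: measurable_rV_coord.
  by apply/funext => z; rewrite !mxE.
have mrs : measurable_fun setT (fun z : 'rV[R]_n => sub_density s (v - z)).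
  exact: (measurableT_comp (measurable_sub_density s) mvz).
have rE r (x : 'rV[R]_n) : 0 < r ->
    (\int[P]_w (gauss_density (S' r w) x)%:E = (sub_density r x)%:E)%E.
  move=> r0; rewrite -(sub_densityE x r0).
  exact/esym/(integral_S' (f := fun r' => (gauss_density r' x)%:E) r0).
have mg1 (z : 'rV[R]_n) r : measurable_fun setT (fun w => (gauss_density (S' r w) z)%:E).
  by apply/measurable_EFinP; exact: measurable_gauss_density.
transitivity (\int[@leb R n]_z \int[P]_w
    ((sub_density s (v - z))%:E * (gauss_density (S' t w) z)%:E))%E.
  apply: eq_integral => z _; rewrite -(rE t)// ge0_integralZl_EFin ?sub_density_ge0//.
  by move=> w _; rewrite lee_fin.
rewrite (fubini_tonelli (fun z : 'rV[R]_n * Omega =>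
  (sub_density s (v - z.1))%:E * (gauss_density (S' t z.2) z.1)%:E)%E) ; last 2 first.
- apply: emeasurable_funM; apply/measurable_EFinP.
    exact: (measurableT_comp mrs).
  apply: measurable_gauss_density => //.
  exact: (measurableT_comp (measurable_S' t)).
- by move=> z; rewrite mule_ge0// lee_fin ?sub_density_ge0.
have inner w' : (\int[@leb R n]_z ((sub_density s (v - z))%:E * (gauss_density (S' t w') z)%:E) =
    \int[P]_w (gauss_density (S' s w + S' t w') v)%:E)%E.
  transitivity (\int[@leb R n]_z \int[P]_w
      ((gauss_density (S' s w) (v - z))%:E * (gauss_density (S' t w') z)%:E))%E.
    apply: eq_integral => z _; rewrite -(rE s)// ge0_integralZr ?lee_fin//.
    by move=> w _; rewrite lee_fin.
  rewrite (fubini_tonelli (fun z : 'rV[R]_n * Omega =>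
    (gauss_density (S' s z.2) (v - z.1))%:E * (gauss_density (S' t w') z.1)%:E)%E) ; last 2 first.
  - apply: emeasurable_funM; apply/measurable_EFinP; apply: measurable_gauss_density => //.
      exact: (measurableT_comp (measurable_S' s)).
    exact: (measurableT_comp mvz).
  - by move=> z; rewrite mule_ge0// lee_fin.
  apply: eq_integral => w _; rewrite -integral_gauss_conv//.
under eq_integral do rewrite inner.
have mgv : measurable_fun setT (fun r : R => (gauss_density r v)%:E) by exact: measurable_gauss_time.
pose Q (r : R) := (\int[P]_w (gauss_density (S' s w + r) v)%:E)%E.
have mQ : measurable_fun setT Q.
  apply: (measurable_fun_fubini_tonelli_F (m2 := P)
    (fun z : R * Omega => (gauss_density (S' s z.2 + z.1) v)%:E)) => [|z]; last by rewrite lee_fin.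
  apply: (measurableT_comp mgv); apply: measurable_funD => //.
  exact: (measurableT_comp (measurable_S' s)).
rewrite -(integral_S' (f := Q))//.
have := integral_subordinatorD (f := fun r => (gauss_density r v)%:E) (ltW t0) (ltW s0) mgv
  (fun r => ltac:(by rewrite lee_fin)).
rewrite (addrC t s) (sub_densityE v (addr_gt0 s0 t0)) => ->.
apply: eq_integral => w _; rewrite /Q.
have := integral_S' (f := fun r => (gauss_density (S t w + r) v)%:E) s0.
have mw : measurable_fun setT (fun r : R => (gauss_density (S t w + r) v)%:E).
  by apply: (measurableT_comp mgv); exact: measurable_funD.
move=> /(_ mw) ->.
by apply: eq_integral => w' _; rewrite addrC.
Qed.

End subordinated_density.

(** * The Euler chain *)

Section markov_chain.
Context {R : realType} {dO : measure_display} {Omega : measurableType dO}.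
Variables (P : probability Omega R).
Context {dE dF : measure_display} {E : measurableType dE} {F : measurableType dF}.

Lemma measurable_preimageT (d1 d2 : measure_display) (T1 : measurableType d1)
    (T2 : measurableType d2) (f : T1 -> T2) (B : set T2) :
  measurable_fun setT f -> measurable B -> measurable (f @^-1` B).
Proof. by move=> mf mB; rewrite -[X in measurable X]setTI; exact: mf. Qed.

(* By induction, [X k] is independent of the whole future [Z k, Z k.+1, ...]. *)
Lemma chain_independent (N : nat) (X : nat -> Omega -> E) (Z : nat -> Omega -> F)
    (G : nat -> E * F -> E) (x0 : E) :
  (forall i, measurable_fun setT (X i)) -> (forall i, measurable_fun setT (Z i)) ->
  (forall i, measurable_fun setT (G i)) ->
  {ae P, forall w, X 0%N w = x0} ->
  (forall i, (i < N)%N -> {ae P, forall w, X i.+1 w = G i (X i w, Z i w)}) ->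
  mutually_independent P (fun i : 'I_N => Z i) ->
  forall k, (k < N)%N -> forall A B, measurable A -> measurable B ->
    P (X k @^-1` A `&` Z k @^-1` B) = (P (X k @^-1` A) * P (Z k @^-1` B))%E.
Proof.
move=> mX mZ mG X0 XS iZ.
pose B' k (B : nat -> set F) i := if (k <= i)%N then B i else setT.
pose D k B := \big[setI/setT]_(i < N) (Z i @^-1` B' k B i).
have mB' k B i : (forall i, measurable (B i)) -> measurable (B' k B i).
  by move=> mB; rewrite /B'; case: ifP.
have mD k B : (forall i, measurable (B i)) -> measurable (D k B).
  by move=> mB; apply: bigsetI_measurable => i _; apply: measurable_preimageT => //; exact: mB'.
have PD k B : (forall i, measurable (B i)) ->
    P (D k B) = (\prod_(i < N) P (Z i @^-1` B' k B i))%E.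
  by move=> mB; apply: (iZ (fun i => B' k B i)) => i; exact: mB'.
have DS k B : (k < N)%N -> D k B = Z k @^-1` B k `&` D k.+1 B.
  move=> kN; apply/seteqP; split => w; rewrite /D.
    rewrite bigsetI_ordP => h; split.
      by have := h (Ordinal kN); rewrite /B' /= leqnn.
    rewrite bigsetI_ordP => i; have := h i; rewrite /= /B'.
    by case: leqP => // ki; case: leqP => // ik; move: ki; rewrite ltnNge (ltnW ik).
  move=> [Zk]; rewrite !bigsetI_ordP => h i; have := h i; rewrite /= /B'.
  case: leqP => // ki; case: ltnP => // ik.
  by have -> : i = k :> nat by apply/eqP; rewrite eqn_leq ki.
have PDS k B : (k < N)%N -> (forall i, measurable (B i)) ->
    P (D k B) = (P (Z k @^-1` B k) * P (D k.+1 B))%E.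
  move=> kN mB; rewrite !PD// (bigD1 (Ordinal kN))//= [in RHS](bigD1 (Ordinal kN))//=.
  rewrite {1}/B' leqnn [X in (_ * (P (_ @^-1` X) * _))%E](_ : _ = setT).
    rewrite preimage_setT probability_setT mul1e; congr (_ * _)%E.
    apply: eq_bigr => i ik; rewrite /B' leq_eqVlt; case: eqP => // ki.
    by case/eqP: ik; exact: val_inj.
  by rewrite /B' ltnn.
have ind k : (k <= N)%N -> forall A B, measurable A -> (forall i, measurable (B i)) ->
    P (X k @^-1` A `&` D k B) = (P (X k @^-1` A) * P (D k B))%E.
  elim: k => [_|k IH kN] A B mA mB.
    have mXA := measurable_preimageT (mX 0%N) mA.
    (* The initial value is almost surely constant, so its events have probability 0 or 1 and are
       independent of everything. *)
    have [Ax|Ax] := pselect (A x0).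
      have full : {ae P, forall w, (X 0%N @^-1` A) w} by apply: filterS X0 => w /= ->.
      rewrite (_ : P (X 0%N @^-1` A) = P setT); last first.
        by apply: prob_ae_eq => //; apply: filterS full => w.
      rewrite probability_setT mul1e; apply: prob_ae_eq => //; [|exact: mD|].
        by apply: measurableI => //; exact: mD.
      by apply: filterS full => w Aw; split => [[]|].
    have emp : {ae P, forall w, ~ (X 0%N @^-1` A) w} by apply: filterS X0 => w /= ->.
    rewrite (prob0_ae mXA emp) mul0e; apply: prob0_ae.
      by apply: measurableI => //; exact: mD.
    by apply: filterS emp => w h [].
  pose X1 : {mfun Omega >-> E} := HB.pack (X k) (isMeasurableFun.Build _ _ _ _ _ (mX k)).
  pose Z1 : {mfun Omega >-> F} := HB.pack (Z k) (isMeasurableFun.Build _ _ _ _ _ (mZ k)).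
  have prodrule (D' : nat -> set F) : (forall i, measurable (D' i)) ->
      forall A1 A2, measurable A1 -> measurable A2 ->
      P (X1 @^-1` A1 `&` Z1 @^-1` A2 `&` D k.+1 D') =
      (P (X1 @^-1` A1) * P (Z1 @^-1` A2) * P (D k.+1 D'))%E.
    move=> mD' A1 A2 mA1 mA2; pose B2 i := if i == k then A2 else D' i.
    have mB2 i : measurable (B2 i) by rewrite /B2; case: ifP.
    have B2k : B2 k = A2 by rewrite /B2 eqxx.
    have DB2 : D k.+1 B2 = D k.+1 D'.
      apply: eq_bigr => i _; rewrite /B' /B2; case: ltnP => // ki.
      by rewrite gtn_eqF.
    rewrite -setIA -muleA -DB2 (_ : Z1 @^-1` A2 `&` _ = D k B2); last first.
      by rewrite (DS k)// B2k.
    by rewrite IH ?(ltnW kN)// PDS// B2k.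
  have mGA : measurable (G k @^-1` A) by exact: measurable_preimageT.
  have mpair : measurable_fun setT (fun w => (X k w, Z k w)) by exact: measurable_fun_pair.
  have stepD D' : (forall i, measurable (D' i)) ->
      P (X k.+1 @^-1` A `&` D k.+1 D') =
      ((distribution P X1 \x distribution P Z1) (G k @^-1` A) * P (D k.+1 D'))%E.
    move=> mD'; rewrite -(joint_law_restr (mD _ _ mD') (prodrule _ mD') mGA).
    apply: prob_ae_eq.
    - by apply: measurableI; [exact: measurable_preimageT|exact: mD].
    - by apply: measurableI; [exact: (measurable_preimageT mpair)|exact: mD].
    - by apply: filterS (XS k kN) => w /= ->.
  have DT : D k.+1 (fun=> setT) = setT.
    by apply/seteqP; split => // w _; rewrite /D bigsetI_ordP => i; rewrite /B' /=; case: ifP.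
  (* The trivial future identifies the product-measure factor as the law of [X k.+1] evaluated at
     A. *)
  have := stepD (fun=> setT) (fun=> measurableT); rewrite DT setIT probability_setT mule1 => ->.
  exact: stepD.
move=> k kN A B mA mB.
have DkE : D k (fun i => if i == k then B else setT) = Z k @^-1` B.
  apply/seteqP; split => w; rewrite /D bigsetI_ordP => h.
    by have := h (Ordinal kN); rewrite /B' /= leqnn eqxx.
  by move=> i; rewrite /B' /=; case: ifP => // _; case: eqP => // ->.
by rewrite -DkE; apply: ind => //; [exact: ltnW|move=> i; case: ifP].
Qed.

End markov_chain.

Section power_increment.
Context {R : realType}.

(** Concavity of the power: (1 - h/t)^theta <= 1 - theta h/t, multiplied by t^theta. This is what
    makes the cost of a drift step telescope. *)
Lemma powR_increment_ge (theta h t : R) : 0 < theta < 1 -> 0 <= h <= t -> 0 < t ->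
  h * t `^ (theta - 1) <= (t `^ theta - (t - h) `^ theta) / theta.
Proof.
move=> /andP[th0 th1] /andP[h0 ht] t0.
have w0 : 0 <= (t - h) / t by apply: divr_ge0; [rewrite subr_ge0|exact: ltW].
have young : ((t - h) / t) `^ theta <= theta * ((t - h) / t) + (1 - theta).
  (* The tangent inequality at 1 is Young's inequality with second factor 1 and conjugate exponents
     1/theta and 1/(1 - theta). *)
  have := @conjugate_powR R (((t - h) / t) `^ theta) 1 theta^-1 (1 - theta)^-1 (powR_ge0 _ _) ler01.
  rewrite !invr_gt0 !invrK subr_gt0 => /(_ th0 th1).
  rewrite addrC subrK => /(_ erefl); rewrite mulr1 powR1 -powRrM mulfV ?gt_eqF// powRr1//.
  by rewrite mul1r [_ * theta]mulrC.
have tE : t `^ theta = t * t `^ (theta - 1).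
  by rewrite mulr_powRB1// ltW.
have thE : (t - h) `^ theta = ((t - h) / t) `^ theta * t `^ theta.
  by rewrite -powRM ?(ltW t0)// divfK// gt_eqF.
rewrite ler_pdivlMr// thE.
have p0 : 0 <= t `^ theta by exact: powR_ge0.
have -> : h * t `^ (theta - 1) * theta = theta * (h / t) * t `^ theta.
  by rewrite [in RHS]tE; field; rewrite gt_eqF.
have : h / t = 1 - (t - h) / t by field; rewrite gt_eqF.
move=> ->; nra.
Qed.

End power_increment.

Section independent_noise.
Context {R : realType} {dO : measure_display} {Omega : measurableType dO}.
Variables (P : probability Omega R).

Lemma integral_independent_density d1 d2 (E : measurableType d1) (F : measurableType d2)
    (mu : {sigma_finite_measure set F -> \bar R}) (X : Omega -> E) (Z : Omega -> F) (p : F -> R)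
    (f : E * F -> \bar R) :
  measurable_fun setT X -> measurable_fun setT Z ->
  (forall A B, measurable A -> measurable B ->
    P (X @^-1` A `&` Z @^-1` B) = (P (X @^-1` A) * P (Z @^-1` B))%E) ->
  has_density P mu Z p -> measurable_fun setT f -> (forall z, 0 <= f z)%E ->
  (\int[P]_w f (X w, Z w) = \int[P]_w \int[mu]_z (f (X w, z) * (p z)%:E))%E.
Proof.
move=> mX mZ iXZ dZ mf f0.
pose X1 : {mfun Omega >-> E} := HB.pack X (isMeasurableFun.Build _ _ _ _ _ mX).
pose Z1 : {mfun Omega >-> F} := HB.pack Z (isMeasurableFun.Build _ _ _ _ _ mZ).
have mp : measurable_fun setT (fun w => (X1 w, Z1 w)) by exact: measurable_fun_pair.
transitivity (\int[pushforward P (fun w => (X1 w, Z1 w))]_z f z)%E.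
  by rewrite ge0_integral_pushforward.
rewrite (eq_measure_integral (distribution P X1 \x distribution P Z1)%E); last first.
  by move=> C mC _; exact: joint_law.
rewrite fubini_tonelli1// ge0_integral_distribution//; last 2 first.
- exact: measurable_fun_fubini_tonelli_F.
- by move=> x; exact: integral_ge0.
have mfX w : measurable_fun setT (fun z => f (X w, z)) by exact: (measurableT_comp mf).
apply: eq_integral => w _; rewrite /= /fubini_F ge0_integral_distribution//.
by rewrite -(ge0_integral_density (f := fun z => f (X w, z)) dZ mZ).
Qed.

Variables (n : nat) (W : R -> {RV P >-> 'rV[R]_n}) (S : R -> {RV P >-> R}) (beta : R).
Hypotheses (hbeta : 1 / 2 < beta < 1) (hW : brownian_motion W)
  (hS : stable_subordinator beta S) (hWS : independent_processes P W S)
  (Spos : forall t, 0 < t -> {ae P, forall w, 0 < S t w}).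

Lemma integral_gauss_mass (t : R) (B : set 'rV[R]_n) : 0 < t -> measurable B ->
  (\int[P]_w gauss_mass B (S t w) = \int[@leb R n]_(y in B) (sub_density S t y)%:E)%E.
Proof.
move=> t0 mB; rewrite [RHS]integral_mkcond.
transitivity (\int[P]_w \int[@leb R n]_y ((gauss_density (S t w) y)%:E * (\1_B y)%:E))%E.
  by apply: eq_integral => w _; rewrite gauss_massE.
have mI : measurable_fun setT (fun y : 'rV[R]_n => (\1_B y : R)%:E).
  exact/measurable_EFinP/measurable_indic.
rewrite (fubini_tonelli (fun z : Omega * 'rV[R]_n => (gauss_density (S t z.1) z.2)%:E * (\1_B z.2)%:E)%E); first last.
- by move=> z; rewrite mule_ge0 ?lee_fin ?gauss_density_ge0.
- apply: emeasurable_funM; last exact: (measurableT_comp mI).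
  apply/measurable_EFinP; apply: measurable_gauss_density => //.
  exact: (measurableT_comp (measurable_funP (S t))).
apply: eq_integral => y _ /=.
rewrite ge0_integralZr ?lee_fin//; last 2 first.
- apply/measurable_EFinP; apply: measurable_gauss_density => //.
- by move=> w _; rewrite lee_fin gauss_density_ge0.
rewrite (sub_densityE hbeta hS Spos y t0) /patch indicE.
by case: ifPn => _; rewrite ?mule1 ?mule0.
Qed.

Lemma subordinated_increments_density (k : nat) (t : nat -> R) (Z : nat -> Omega -> 'rV[R]_n) :
  0 <= t 0%N -> (forall i, t i <= t i.+1) -> (forall i, (i < k)%N -> t i < t i.+1) ->
  (forall i, measurable_fun setT (Z i)) ->
  (forall i, (i < k)%N ->
    {ae P, forall w, Z i w = W (S (t i.+1) w) w - W (S (t i) w) w}) ->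
  mutually_independent P (fun i : 'I_k => Z i) /\
  forall i, (i < k)%N -> has_density P (@leb R n) (Z i) (sub_density S (t i.+1 - t i)).
Proof.
move=> t0 tS tk mZ ZE.
have law := subordinated_increments_law hW hS hWS Spos t0 tS tk mZ ZE.
pose kap i (B : set 'rV[R]_n) := (\int[P]_w gauss_mass B (S (t i.+1 - t i)%R w))%E.
have kapT i : (i < k)%N -> kap i setT = 1%E.
  move=> ik; rewrite /kap -[RHS](@prob_integral_cst _ _ _ P); apply: ae_eq_integral => //.
    by apply: (measurableT_comp (measurable_gauss_mass _)).
  have [_ _ dW _] := hW.
  have ti0 : 0 < t i.+1 - t i by rewrite subr_gt0 tk.
  apply: filterS (Spos ti0) => w w0 _.
  have [_ _ hs] := dW 0 _ (lexx _) w0; rewrite subr0 in hs.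
  by rewrite /gauss_mass -hs// preimage_setT probability_setT.
(* Taking all other sets full in the product formula isolates one marginal, since each [kap] has
   total mass 1; the same formula then reads as independence. *)
have one i : (i < k)%N -> forall B, measurable B -> P (Z i @^-1` B) = kap i B.
  move=> ik B mB; pose B' j := if j == i then B else setT.
  have mB' j : measurable (B' j) by rewrite /B'; case: ifP.
  have B'j (j : 'I_k) : j != Ordinal ik -> B' j = setT.
    by move=> jk; rewrite /B' ifN//; apply: contra jk => /eqP ji; apply/eqP/val_inj.
  have B'i : B' i = B by rewrite /B' eqxx.
  have := law B' mB'; rewrite (bigD1 (Ordinal ik))//= [in RHS](bigD1 (Ordinal ik))//= B'i.
  rewrite (eq_bigr (fun=> setT)) => [|j jk]; last by rewrite B'j.
  rewrite big1_eq setIT => ->.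
  rewrite [X in (_ * X)%E](eq_bigr (fun=> 1%E)) => [|j jk]; last by rewrite B'j// [LHS]kapT.
  by rewrite big1_eq mule1.
split=> [B mB|i ik].
  pose B' j := if insub j is Some i then B i else setT.
  have mB' j : measurable (B' j) by rewrite /B'; case: insubP.
  have B'E (i : 'I_k) : B' i = B i by rewrite /B' valK.
  have := law B' mB'.
  rewrite (eq_bigr (fun i : 'I_k => Z i @^-1` B i)) => [->|i _]; last by rewrite B'E.
  by apply: eq_bigr => i _; rewrite B'E one.
split; first exact: measurable_sub_density.
- by move=> y; exact: sub_density_ge0.
- by move=> A mA; rewrite one// /kap integral_gauss_mass// subr_gt0 tk.
Qed.

End independent_noise.

(** * Continuity from a Harnack inequality *)

Section continuity.
Context {R : realType}.

Lemma nbhs_enorm n (y : 'rV[R]_n) (e : R) : 0 < e ->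
  \forall y' \near nbhs y, enorm (y - y') <= e.
Proof.
move=> e0; apply/nbhs_ballP; exists (e / n.+1%:R); first by rewrite /= divr_gt0.
move=> y' [_ yy']; apply: (@le_trans _ _ (n%:R * (e / n.+1%:R))).
  apply: enorm_le_coord; first by rewrite divr_ge0// ltW.
  move=> i; rewrite !mxE; apply: ltW.
  have : ball (y ord0 i) (e / n.+1%:R) (y' ord0 i) by exact: yy'.
  by [].
by rewrite mulrCA -[leRHS]mulr1 ler_wpM2l ?(ltW e0)// ler_pdivrMr// mul1r ler_nat.
Qed.

Lemma harnack_continuous n (p : 'rV[R]_n -> R) (c r : R) : 0 <= c -> 0 < r ->
  (forall y, 0 <= p y) ->
  (forall y v, enorm v <= r -> p (y - v) <= (1 + c * enorm v) * p y) -> continuous p.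
Proof.
move=> c0 r0 p0 hp y; have Fy : Filter (nbhs y) by exact: nbhs_filter.
apply/(@cvgrPdist_le _ _ _ (nbhs y) Fy) => e e0.
(* The inequality is applied from y to y' and back. The first two bounds give p y' <= 2 p y; the
   increment is then at most 2 c |y - y'| p y in either direction, and the third bound makes this at
   most e. *)
pose eta := Num.min (Num.min r (c + 1)^-1) (e / (2 * (c + 1) * (p y + 1))).
have eta0 : 0 < eta.
  rewrite !lt_min r0 invr_gt0 divr_gt0// ?mulr_gt0//; have := p0 y; lra.
apply: filterS (nbhs_enorm y eta0) => y' ye.
have er : enorm (y - y') <= r by apply: (le_trans ye); rewrite !ge_min lexx.
have e1 : c * enorm (y - y') <= 1.
  have : enorm (y - y') <= (c + 1)^-1 by apply: (le_trans ye); rewrite !ge_min lexx orbT.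
  rewrite -[X in _ <= X]mul1r ler_pdivlMr; last lra.
  have := enorm_ge0 (y - y'); nra.
have e2 : 2 * (c + 1) * (p y + 1) * enorm (y - y') <= e.
  have : enorm (y - y') <= e / (2 * (c + 1) * (p y + 1)).
    by apply: (le_trans ye); rewrite !ge_min lexx orbT.
  rewrite ler_pdivlMr 1?mulrC// !mulr_gt0//; have := p0 y; lra.
have h1 := hp y (y - y') er; rewrite subKr in h1.
have h2 := hp y' (y' - y); rewrite subKr -enormN opprB in h2.
have {}h2 := h2 er.
have := enorm_ge0 (y - y'); set E := enorm _ in er e1 e2 h1 h2 *; move=> E0.
have py := p0 y; have py' := p0 y'.
have cE : 0 <= c * E by rewrite mulr_ge0.
have k1 : 2 * (c * E) * p y <= e.
  apply: le_trans e2; rewrite (_ : 2 * (c + 1) * (p y + 1) * E = 2 * (c * E) * p y + 2 * (E * p y + c * E + E)); last ring.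
  rewrite lerDl mulr_ge0// !addr_ge0// mulr_ge0//.
have k2 : p y' <= 2 * p y by nra.
rewrite ler_norml; apply/andP; split; nra.
Qed.

End continuity.

Section euler_chain.
Context {R : realType} {dO : measure_display} {Omega : measurableType dO}.
Variables (P : probability Omega R).
Variables (n : nat) (W : R -> {RV P >-> 'rV[R]_n}) (S : R -> {RV P >-> R}) (beta : R).
Hypotheses (hbeta : 1 / 2 < beta < 1) (hW : brownian_motion W)
  (hS : stable_subordinator beta S) (hWS : independent_processes P W S)
  (Spos : forall t, 0 < t -> {ae P, forall w, 0 < S t w}).
Variables (b : 'rV[R]_n -> 'rV[R]_n) (M T : R).
Hypotheses (mb : measurable_fun setT b) (M0 : 0 <= M) (hM : forall x, enorm (b x) <= M)
  (T0 : 0 < T).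

Let rho := @sub_density R dO Omega P n S.
Let theta := 1 - (2 * beta)^-1.

Let theta01 : 0 < theta < 1.
Proof.
case/andP: hbeta => b1 b2; rewrite /theta subr_gt0 invf_lt1; last lra.
rewrite ltrBlDr ltrDl invr_gt0; apply/andP; split; lra.
Qed.

Let drift (h : R) (x : 'rV[R]_n) := x + h *: b x.

Let measurable_drift h : measurable_fun setT (drift h).
Proof.
apply/measurable_fun_rVP => i.
rewrite (_ : (fun _ => _) = fun x : 'rV[R]_n => x ord0 i + h * b x ord0 i).
  apply: measurable_funD; first exact: measurable_rV_coord.
  apply: measurable_funM => //.
  by apply: (measurableT_comp (measurable_rV_coord i) mb).
by apply/funext => x; rewrite !mxE.
Qed.

(* One step of the drift costs a factor [1 + O(h t ^ (- 1 / alpha))], whose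
   product along the scheme telescopes. *)
Lemma sub_density_drift : exists C : R, exists r : R, [/\ 0 <= C, 0 < r,
  (forall h t y x, 0 <= h <= t -> 0 < t -> t <= T ->
    rho t (y - drift h x) <= expR (C * (t `^ theta - (t - h) `^ theta)) * rho t (y - x)) &
  (forall t y v, 0 < t -> enorm v <= t `^ (2 * beta)^-1 ->
    rho t (y - v) <= (1 + r * t `^ (- (2 * beta)^-1) * enorm v) * rho t y)].
Proof.
have /andP[th0 th1] := theta01.
(* The first summand covers a drift step, since h M <= t M <= M T^theta t^(1/alpha); the 1 covers
   the free shift v of the last clause. *)
pose K := M * T `^ theta + 1.
have K0 : 0 <= K by rewrite addr_ge0// mulr_ge0 ?powR_ge0.
have [C C0 HC] := sub_density_harnack n hbeta hS Spos K0.
exists (C * M / theta), C; split => //.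
- by rewrite divr_ge0 ?(ltW th0)// mulr_ge0// ltW.
- move=> h t y x /andP[h0 ht] t0 tT.
  have vM : enorm (h *: b x) <= h * M by rewrite enormZ// ler_wpM2l.
  have tE : t = t `^ theta * t `^ (2 * beta)^-1.
    rewrite -powRD ?(gt_eqF t0) ?implybT// /theta subrK powRr1//; exact: ltW.
  have vK : enorm (h *: b x) <= K * t `^ (2 * beta)^-1.
    apply: (le_trans vM); apply: (@le_trans _ _ (t * M)); first by rewrite ler_wpM2r.
    rewrite [in leLHS]tE mulrAC ler_wpM2r ?powR_ge0//.
    have : t `^ theta <= T `^ theta.
      by rewrite ge0_ler_powR ?nnegrE ?(ltW th0) ?(ltW t0) ?(ltW T0).
    move=> /(ler_wpM2r M0); rewrite /K; lra.
  rewrite /drift opprD addrA; apply: (le_trans (HC t (y - x) _ t0 vK)).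
  rewrite ler_wpM2r ?sub_density_ge0//; apply: le_trans (expR_ge1Dx _).
  rewrite lerD2l -!mulrA ler_wpM2l ?(ltW C0)//.
  have -> : - (2 * beta)^-1 = theta - 1 by rewrite /theta; ring.
  apply: (@le_trans _ _ (M * (h * t `^ (theta - 1)))).
    by rewrite [leRHS]mulrA (mulrC M) ler_wpM2r// powR_ge0.
  rewrite ler_wpM2l// [leRHS]mulrC; apply: powR_increment_ge => //; exact/andP.
- move=> t y v t0 vt; rewrite -mulrA [_ * enorm v]mulrC; apply: HC => //.
  by apply: (le_trans vt); rewrite ler_peMl ?powR_ge0// /K lerDr mulr_ge0// powR_ge0.
Qed.

(** Stated for an arbitrary time grid because the last step of the scheme, ending at t, may be
    shorter than the others. The constant depends on neither the number of steps nor their sizes. *)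
Lemma euler_chain_density : exists2 C : R, 0 < C &
  forall (N : nat) (tau : nat -> R) (X : nat -> Omega -> 'rV[R]_n) (x0 : 'rV[R]_n),
  0 <= tau 0%N -> (forall i, tau i <= tau i.+1) -> (forall i, (i <= N)%N -> tau i < tau i.+1) ->
  tau N.+1 - tau 0%N <= T ->
  (forall i, measurable_fun setT (X i)) -> {ae P, forall w, X 0%N w = x0} ->
  (forall i, (i <= N)%N -> {ae P, forall w, X i.+1 w =
     X i w + (tau i.+1 - tau i) *: b (X i w) + (W (S (tau i.+1) w) w - W (S (tau i) w) w)}) ->
  exists p : 'rV[R]_n -> R, [/\ has_density P (@leb R n) (X N.+1) p, continuous p &
    forall y, p y <= C * rho (tau N.+1 - tau 0%N) (y - x0)].
Proof.
have /andP[th0 th1] := theta01.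
have [L [r [L0 r0 HL Hr]]] := sub_density_drift.
exists (expR (L * T `^ theta)); first exact: expR_gt0.
move=> N tau X x0 tau0 tauS tauN tauT mX X0 XS.
pose h i := tau i.+1 - tau i.
have h0 i : (i <= N)%N -> 0 < h i by move=> iN; rewrite subr_gt0 tauN.
(* Defining the noise as the residual makes it measurable and the recursion [GE] true everywhere;
   only its identification with an increment is almost sure. *)
pose Z i w := X i.+1 w - drift (h i) (X i w).
have mZ i : measurable_fun setT (Z i).
  apply/measurable_fun_rVP => l.
  rewrite (_ : (fun _ => _) = fun w => X i.+1 w ord0 l - drift (h i) (X i w) ord0 l).
    apply: measurable_funB; apply: (measurableT_comp (measurable_rV_coord l)) => //.
    exact: (measurableT_comp (measurable_drift (h i)) (mX i)).
  by apply/funext => w; rewrite !mxE.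
have ZE i : (i < N.+1)%N ->
    {ae P, forall w, Z i w = W (S (tau i.+1) w) w - W (S (tau i) w) w}.
  by move=> iN; apply: filterS (XS i iN) => w XE; rewrite /Z XE /drift /h addrAC subrr add0r.
have [iZ dZ] := subordinated_increments_density (k := N.+1) hbeta hW hS hWS Spos tau0 tauS tauN mZ ZE.
pose G i (z : 'rV[R]_n * 'rV[R]_n) := drift (h i) z.1 + z.2.
have mG i : measurable_fun setT (G i).
  apply/measurable_fun_rVP => l.
  rewrite (_ : (fun _ => _) = fun z : 'rV[R]_n * 'rV[R]_n => drift (h i) z.1 ord0 l + z.2 ord0 l).
    apply: measurable_funD; apply: (measurableT_comp (measurable_rV_coord l)) => //.
    exact: (measurableT_comp (measurable_drift (h i)) measurable_fst).
  by apply/funext => z; rewrite !mxE.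
have GE i w : X i.+1 w = G i (X i w, Z i w) by rewrite /G /Z /= subrKC.
have aeG i : (i < N.+1)%N -> {ae P, forall w, X i.+1 w = G i (X i w, Z i w)}.
  by move=> _; apply: nearW.
have iXZ := chain_independent mX mZ mG X0 aeG iZ.
have step k (f : 'rV[R]_n -> \bar R) : (k <= N)%N -> measurable_fun setT f ->
    (forall x, 0 <= f x)%E ->
    (\int[P]_w f (X k.+1 w) =
     \int[P]_w \int[@leb R n]_z (f (drift (h k) (X k w) + z)%R * (rho (h k) z)%:E))%E.
  move=> kN mf f0.
  rewrite -(integral_independent_density (f := fun z => f (G k z)) (mX k) (mZ k) (iXZ k kN) (dZ k kN))//.
  - by apply: eq_integral => w _; rewrite GE.
  - exact: (measurableT_comp mf (mG k)).
have mrho t : measurable_fun setT (rho t) by exact: measurable_sub_density.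
have mVy i (y : 'rV[R]_n) : measurable_fun setT (fun x : 'rV[R]_n => y - drift (h i) x).
  apply/measurable_fun_rVP => l.
  rewrite (_ : (fun _ => _) = fun x => y ord0 l - drift (h i) x ord0 l).
    apply: measurable_funB => //.
    exact: (measurableT_comp (measurable_rV_coord l) (measurable_drift (h i))).
  by apply/funext => x; rewrite !mxE.
have mVy0 (y : 'rV[R]_n) : measurable_fun setT (fun x : 'rV[R]_n => y - x).
  apply/measurable_fun_rVP => l.
  rewrite (_ : (fun _ => _) = fun x : 'rV[R]_n => y ord0 l - x ord0 l).
    by apply: measurable_funB => //; exact: measurable_rV_coord.
  by apply/funext => x; rewrite !mxE.
pose U k t y := (\int[P]_w (rho t (y - X k w))%:E)%E.
pose V k t y := (\int[P]_w (rho t (y - drift (h k) (X k w)))%:E)%E.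
have VU k t y : (k <= N)%N -> h k <= t -> t <= T ->
    (V k t y <= (expR (L * (t `^ theta - (t - h k) `^ theta)))%:E * U k t y)%E.
  move=> kN ht tT; have hk0 := h0 k kN.
  rewrite -ge0_integralZl_EFin ?expR_ge0//; last 2 first.
  - by move=> w _; rewrite lee_fin sub_density_ge0.
  - apply/measurable_EFinP; apply: (measurableT_comp (mrho t)).
    exact: (measurableT_comp (mVy0 y) (mX k)).
  apply: ge0_le_integral => //.
  - by move=> w _; rewrite lee_fin sub_density_ge0.
  - apply/measurable_EFinP; apply: (measurableT_comp (mrho t)).
    exact: (measurableT_comp (mVy k y) (mX k)).
  - apply/measurable_EFinP; apply: measurable_funM => //; apply: (measurableT_comp (mrho t)).
    exact: (measurableT_comp (mVy0 y) (mX k)).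
  - move=> w _; rewrite -EFinM lee_fin; apply: HL => //; last exact: lt_le_trans ht.
    by rewrite ht (ltW hk0).
have UV k t y : (k <= N)%N -> 0 < t -> U k.+1 t y = V k (t + h k) y.
  move=> kN t0; rewrite /U (step k (fun x => (rho t (y - x))%:E))//; last 2 first.
  - apply/measurable_EFinP; exact: (measurableT_comp (mrho t) (mVy0 y)).
  - by move=> x; rewrite lee_fin sub_density_ge0.
  apply: eq_integral => w _; under eq_integral do rewrite opprD addrA.
  exact: (integral_sub_density_conv hbeta hS Spos (y - drift (h k) (X k w)) t0 (h0 k kN)).
pose H := tau N.+1 - tau 0%N.
have tau_le i j : (i <= j)%N -> tau i <= tau j.
  by move=> /subnK <-; elim: (j - i)%N => // m IHm; apply: (le_trans IHm); rewrite addSn.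
have Ubound k y : (k <= N)%N ->
    (U k (tau N.+1 - tau k)%R y <=
     (expR (L * (H `^ theta - (tau N.+1 - tau k) `^ theta)) * rho H (y - x0))%:E)%E.
  elim: k => [_|k IH kN].
    rewrite subrr mulr0 expR0 mul1r /U.
    rewrite (_ : integral _ _ _ = (rho H (y - x0))%:E)// -[RHS](@prob_integral_cst _ _ _ P).
    apply: ae_eq_integral => //.
      apply/measurable_EFinP; apply: (measurableT_comp (mrho _)).
      exact: (measurableT_comp (mVy0 y) (mX 0%N)).
    by apply: filterS X0 => w -> _.
  have tk : 0 < tau N.+1 - tau k.+1.
    by rewrite subr_gt0 (le_lt_trans (tau_le _ _ kN))// tauN.
  rewrite UV ?(ltW kN)//; last exact: ltnW.
  have -> : tau N.+1 - tau k.+1 + h k = tau N.+1 - tau k by rewrite /h; ring.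
  have hk : h k <= tau N.+1 - tau k by rewrite lerB// tau_le// ltnS ltnW.
  have tT : tau N.+1 - tau k <= T by apply: le_trans tauT; rewrite lerB// tau_le.
  apply: (le_trans (VU k _ y (ltnW kN) hk tT)).
  have -> : tau N.+1 - tau k - h k = tau N.+1 - tau k.+1 by rewrite /h; ring.
  apply: (le_trans (lee_wpmul2l _ (IH (ltnW kN)))); first by rewrite lee_fin expR_ge0.
  rewrite -EFinM lee_fin mulrA -expRD ler_wpM2r ?sub_density_ge0// ler_expR; lra.
have hN0 : 0 < h N by exact: h0.
(* The last noise has a density, so averaging its translates over the position reached before it
   gives a density of the endpoint. *)
pose q y := V N (h N) y.
have qbound y : (q y <= (expR (L * T `^ theta) * rho H (y - x0))%:E)%E.
  have hT : h N <= T by apply: le_trans tauT; rewrite lerB// tau_le.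
  apply: (le_trans (VU N (h N) y (leqnn N) (lexx _) hT)).
  apply: (le_trans (lee_wpmul2l _ (Ubound N y (leqnn N)))); first by rewrite lee_fin expR_ge0.
  rewrite -EFinM lee_fin mulrA -expRD ler_wpM2r ?sub_density_ge0// ler_expR.
  (* The last drift step uses up all the time to go, so the telescoping exponent ends at 0^theta =
     0. *)
  rewrite subrr (powR0 (lt0r_neq0 th0)) subr0 -/(h N).
  have : H `^ theta <= T `^ theta.
    rewrite ge0_ler_powR ?nnegrE ?(ltW th0) ?(ltW T0)//.
    by rewrite /H subr_ge0 tau_le.
  by move=> /(ler_wpM2l L0); lra.
have q0 y : (0 <= q y)%E.
  by apply: integral_ge0 => w _; rewrite lee_fin sub_density_ge0.
have qE y : q y = (fine (q y))%:E.
  by rewrite fineK// ge0_fin_numE//; exact: le_lt_trans (qbound y) (ltry _).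
have mpair : measurable_fun setT (fun z : 'rV[R]_n * Omega =>
    (rho (h N) (z.1 - drift (h N) (X N z.2)))%:E).
  apply/measurable_EFinP; apply: (measurableT_comp (mrho (h N))).
  apply/measurable_fun_rVP => l.
  rewrite (_ : (fun _ => _) = fun z : 'rV[R]_n * Omega => z.1 ord0 l - drift (h N) (X N z.2) ord0 l).
    apply: measurable_funB; apply: (measurableT_comp (measurable_rV_coord l)) => //.
    apply: (measurableT_comp (measurable_drift (h N))).
    exact: (measurableT_comp (mX N)).
  by apply/funext => z; rewrite !mxE.
have qV y : q y = (\int[P]_w (rho (h N) (y - drift (h N) (X N w)))%:E)%E by [].
have mq : measurable_fun setT q.
  by apply: (measurable_fun_fubini_tonelli_F _ mpair) => z; rewrite lee_fin sub_density_ge0.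
clearbody q; exists (fine \o q); split.
- split.
  + exact: measurableT_comp.
  + by move=> y; exact: fine_ge0.
  + move=> A mA; rewrite prob_indicE; last exact: measurable_preimageT.
    transitivity (\int[P]_w (\1_A (X N.+1 w))%:E)%E; first by [].
    rewrite (step N (fun x => (\1_A x)%:E))//; last first.
      exact/measurable_EFinP/measurable_indic.
    transitivity (\int[P]_w \int[@leb R n]_y ((\1_A y)%:E *
        (rho (h N) (y - drift (h N) (X N w)))%:E))%E.
      apply: eq_integral => w _; set v := drift _ _.
      have mf : measurable_fun setT (fun z : 'rV[R]_n => (\1_A (v + z))%:E * (rho (h N) z)%:E)%E.
        apply: emeasurable_funM; apply/measurable_EFinP => //.
        apply: (measurableT_comp (measurable_indic _)) => //.
        rewrite (_ : +%R v = fun z => z + v); first exact: measurable_rV_add.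
        by apply/funext => z; rewrite addrC.
      have f0 z : (0 <= (\1_A (v + z))%:E * (rho (h N) z)%:E)%E.
        by rewrite mule_ge0 ?lee_fin ?sub_density_ge0.
      (* The substitution z = y - v recentres the noise density at the endpoint y. *)
      apply: etrans (esym (integral_leb_translate (- v) mf f0)) _.
      by apply: eq_integral => y _; rewrite subrKC.
    rewrite -(fubini_tonelli (fun z : 'rV[R]_n * Omega => (\1_A z.1)%:E *
        (rho (h N) (z.1 - drift (h N) (X N z.2)))%:E)%E); last 2 first.
    - apply: emeasurable_funM => //; apply/measurable_EFinP.
      by apply: (measurableT_comp (measurable_indic _)).
    - by move=> z; rewrite mule_ge0 ?lee_fin ?sub_density_ge0.
    rewrite [RHS]integral_mkcond; apply: eq_integral => y _ /=.
    rewrite ge0_integralZl_EFin//; last 2 first.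
    - by move=> w _; rewrite lee_fin sub_density_ge0.
    - apply/measurable_EFinP; apply: (measurableT_comp (mrho _)).
      exact: (measurableT_comp (mVy N y) (mX N)).
    rewrite -qV /patch indicE /=.
    by case: ifPn => _; rewrite ?mul1e ?mul0e -?qE.
(* The Harnack inequality for the last noise density, with constants independent of the centre,
   survives averaging over [X N]. *)
- apply: (@harnack_continuous _ _ _ (r * h N `^ (- (2 * beta)^-1)) (h N `^ (2 * beta)^-1)).
  + by rewrite mulr_ge0 ?powR_ge0// ltW.
  + by rewrite powR_gt0.
  + by move=> y; exact: fine_ge0.
  + move=> y v vr.
    suff : (q (y - v)%R <= (1 + r * h N `^ (- (2 * beta)^-1) * enorm v)%:E * q y)%E.
      by rewrite (qE (y - v)) (qE y) -EFinM lee_fin.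
    rewrite (qV (y - v)) (qV y) -ge0_integralZl_EFin//; last 3 first.
    * by move=> w _; rewrite lee_fin sub_density_ge0.
    * apply/measurable_EFinP; apply: (measurableT_comp (mrho _)).
      exact: (measurableT_comp (mVy N y) (mX N)).
    * by rewrite addr_ge0// !mulr_ge0 ?enorm_ge0 ?powR_ge0// ltW.
    apply: ge0_le_integral => //.
    * by move=> w _; rewrite lee_fin sub_density_ge0.
    * apply/measurable_EFinP; apply: (measurableT_comp (mrho _)).
      exact: (measurableT_comp (mVy N (y - v)) (mX N)).
    * apply/measurable_EFinP; apply: measurable_funM => //; apply: (measurableT_comp (mrho _)).
      exact: (measurableT_comp (mVy N y) (mX N)).
    * move=> w _; rewrite -EFinM lee_fin addrAC; exact: Hr.
- by move=> y; rewrite -lee_fin /= -qE; exact: qbound.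
Qed.

End euler_chain.

(** * The Euler-Maruyama scheme on its grid *)

Section piecewise_constant.
Context {R : realType}.
Notation mu := (@lebesgue_measure R).

(** Half-open intervals match the right-continuity of the grid. Integrability is carried along
    because additivity of the real-valued integral needs it. *)
Lemma integral_piecewise_step (f : R -> R) (s a c k : R) : s <= a -> a <= c ->
  mu.-integrable `[s, a[%classic (EFin \o f) ->
  (forall u, a <= u < c -> f u = k) ->
  mu.-integrable `[s, c[%classic (EFin \o f) /\
  \int[mu]_(u in `[s, c[%classic) f u = \int[mu]_(u in `[s, a[%classic) f u + (c - a) * k.
Proof.
move=> sa ac fsa fk.
have mI (x y : R) : measurable `[x, y[%classic by exact: measurable_itv.
have E : `[s, c[%classic = `[s, a[%classic `|` `[a, c[%classic.
  apply/seteqP; split => u /=; rewrite !in_itv/=.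
    by move=> /andP[su uc]; have [ua|ua] := ltP u a; [left; apply/andP|right; apply/andP].
  by move=> [/andP[su ua]|/andP[au uc]]; apply/andP; split => //;
    [exact: lt_le_trans ac|exact: le_trans au].
have dis : [disjoint `[s, a[%classic & `[a, c[%classic].
  apply/eqP; apply/seteqP; split => u //=; rewrite !in_itv/= => -[/andP[_ ua] /andP[au _]].
  by have := lt_le_trans ua au; rewrite ltxx.
have fac : mu.-integrable `[a, c[%classic (EFin \o f).
  have fE : {in `[a, c[%classic, (cst k%:E) =1 EFin \o f}.
    by move=> u; rewrite inE /= in_itv/= => uac; rewrite fk.
  apply: (@eq_integrable _ _ _ mu _ (mI a c) _ _ fE).
  apply/integrableP; split => //.
  rewrite [ltLHS](integral_cst mu (mI a c) `|k%:E|%E); apply: lte_mul_pinfty => //.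
  by rewrite /= lebesgue_measure_itv/=; case: ifP => _; exact: ltry.
have fsc : mu.-integrable `[s, c[%classic (EFin \o f).
  rewrite E; apply/integrableP; split.
    by apply/measurable_funU => //; split; [exact: (measurable_int mu fsa)|exact: (measurable_int mu fac)].
  rewrite ge0_integral_setU//; last first.
    apply: measurableT_comp => //.
    by apply/measurable_funU => //; split; [exact: (measurable_int mu fsa)|exact: (measurable_int mu fac)].
  by apply: lte_add_pinfty; [have /integrableP[] := fsa|have /integrableP[] := fac].
split => //; rewrite E Rintegral_setU//; last by rewrite -E.
congr (_ + _); rewrite (@eq_Rintegral _ _ _ mu `[a, c[%classic (cst k) f); last first.
  by move=> u; rewrite inE /= in_itv/= => uac; rewrite fk.
rewrite Rintegral_cst//= lebesgue_measure_itv/= lte_fin mulrC; congr (_ * _).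
case: ltP => [_|ca]; first by rewrite -?EFinB.
by have -> : c = a by [apply/eqP; rewrite eq_le ca ac]; rewrite subrr.
Qed.

Lemma integral_piecewise (f : R -> R) (tau k : nat -> R) (N : nat) :
  (forall i, (i < N)%N -> tau i <= tau i.+1) ->
  (forall i u, (i < N)%N -> tau i <= u < tau i.+1 -> f u = k i) ->
  forall i, (i <= N)%N ->
  mu.-integrable `[tau 0%N, tau i[%classic (EFin \o f) /\
  \int[mu]_(u in `[tau 0%N, tau i]%classic) f u = \sum_(l < i) (tau l.+1 - tau l) * k l.
Proof.
move=> tauS fk i iN.
suff [fi <-] : mu.-integrable `[tau 0%N, tau i[%classic (EFin \o f) /\
    \int[mu]_(u in `[tau 0%N, tau i[%classic) f u = \sum_(l < i) (tau l.+1 - tau l) * k l.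
  by split => //; rewrite Rintegral_itv_bndo_bndc.
have tau_le m : (m <= N)%N -> tau 0%N <= tau m.
  by elim: m => // m IH mN; apply: (le_trans (IH (ltnW mN))); exact: tauS.
elim: i iN => [_|i IH iN].
  rewrite big_ord0 (_ : `[tau 0%N, tau 0%N[%classic = set0); last first.
    apply/seteqP; split => u //=; rewrite in_itv/= => /andP[u1 u2].
    by have := le_lt_trans u1 u2; rewrite ltxx.
  by split; [exact: integrable_set0|rewrite Rintegral_set0].
have [fi Ei] := IH (ltnW iN).
have [fS ES] := integral_piecewise_step (tau_le _ (ltnW iN)) (tauS i iN) fi (fun u => fk i u iN).
by split => //; rewrite ES Ei big_ord_recr.
Qed.

End piecewise_constant.

Lemma grid_floorE (R : realType) (delta u : R) (m : nat) : 0 < delta ->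
  m%:R * delta <= u < m.+1%:R * delta -> grid_floor delta u = m%:R * delta.
Proof.
move=> d0 /andP[mu um]; rewrite /grid_floor; congr (_ * _).
rewrite (_ : Num.floor (u / delta) = m%:Z)//; apply: floor_def.
rewrite ler_pdivlMr// ltr_pdivrMr// -[(m%:Z)%:~R]/(m%:R) mu /=.
by rewrite intrD -[(m%:Z)%:~R]/(m%:R) natr1.
Qed.

(** A law with a density does not charge the point 0. *)
Lemma subordinator_gt0 (R : realType) (dO : measure_display) (Omega : measurableType dO)
    (P : probability Omega R) (beta : R) (S : R -> {RV P >-> R}) (p : R -> R) (t : R) :
  stable_subordinator beta S -> 0 <= t -> has_density P lebesgue_measure (S t) p ->
  {ae P, forall w, 0 < S t w}.
Proof.
move=> [_ S0 _ _] t0 [mp p0 Sp].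
have m1 : measurable [set 0 : R] by exact: measurable_set1.
have : {ae P, forall w, ~ (S t @^-1` [set 0]) w}.
  apply: ae_prob0; first exact: measurable_preimageT.
  by rewrite Sp// integral_set1.
by apply: filterS2 S0 => w Sw /eqP Sw0; rewrite lt0r Sw0 Sw.
Qed.

Theorem theorem2p1 (R : realType) (d : nat) (hd : (0 < d)%N)
    (dO : measure_display) (Omega : measurableType dO)
    (P : probability Omega R)
    (alpha : R) (halpha : 1 < alpha < 2)
    (W : R -> {RV P >-> 'rV[R]_d}) (hW : brownian_motion W)
    (S : R -> {RV P >-> R}) (hS : stable_subordinator (alpha / 2) S)
    (hWS : independent_processes P W S)
    (eta : R -> R -> R)
    (heta : forall t, 0 < t -> has_density P lebesgue_measure (S t) (eta t))
    (b : 'rV[R]_d -> 'rV[R]_d) (mb : measurable_fun setT b)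
    (hb : exists M : R, forall x, enorm (b x) <= M)
    (T : R) (hT : 0 < T) :
  exists C : R, 0 < C /\
    forall (x : 'rV[R]_d) (delta : R) (j : nat) (t : R),
      0 < delta < 1 -> j%:R * delta < t -> t <= T ->
    forall X : R -> {RV P >-> 'rV[R]_d},
      euler_maruyama b W S delta (j%:R * delta) x X ->
    exists p : 'rV[R]_d -> R, is_transition_density (X t) p /\
      forall y : 'rV[R]_d,
        ((p y)%:E <= C%:E * p_alpha eta (t - j%:R * delta) (y - x))%E.
Proof.
have Spos t : 0 < t -> {ae P, forall w, 0 < S t w}.
  by move=> t0; apply: (subordinator_gt0 hS (ltW t0) (heta t t0)).
have [M hM] := hb.
have M0 : 0 <= M by apply: le_trans (hM 0); exact: enorm_ge0.
have hbeta : 1 / 2 < alpha / 2 < 1.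
  by case/andP: halpha => a1 a2; apply/andP; split; lra.
have [C C0 HC] := euler_chain_density hbeta hW hS hWS Spos mb M0 hM hT.
exists C; split => // x delta j t /andP[d0 _] jt tT X EX.
set s := j%:R * delta in jt EX *.
have s0 : 0 <= s by rewrite mulr_ge0// ltW.
(* The least such N: the points s + i delta with i <= N lie strictly before t, and adding t as last
   point gives N + 1 nondegenerate steps of length at most delta. *)
have [N [tN Nt]] : exists N : nat, t <= s + N.+1%:R * delta /\
    forall i : nat, (i <= N)%N -> s + i%:R * delta < t.
  have ex : exists N : nat, t <= s + N.+1%:R * delta.
    exists (Num.truncn ((t - s) / delta)); rewrite -lerBlDl -ler_pdivrMr//.
    exact/ltW/truncnS_gt.
  have [N tN minN] := ex_minnP ex; exists N; split => // -[_|i iN].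
    by rewrite mul0r addr0.
  by rewrite ltNge; apply/negP => /minN; rewrite leqNgt iN.
pose tau i := if (i <= N)%N then s + i%:R * delta else t.
have tauE i : (i <= N)%N -> tau i = s + i%:R * delta by rewrite /tau => ->.
have tauN1 : tau N.+1 = t by rewrite /tau ltnn.
have tau0 : tau 0%N = s by rewrite tauE// mul0r addr0.
have tau_lt i : (i <= N)%N -> tau i < tau i.+1.
  move=> iN; rewrite (tauE i iN) /tau; case: ifP => _; last exact: Nt.
  by rewrite ltrD2l ltr_pM2r// ltr_nat.
have tau_leS i : tau i <= tau i.+1.
  have [iN|iN] := leqP i N; first exact/ltW/tau_lt.
  by rewrite /tau !ifN// -ltnNge// ltnW.
have tau_le_next i : (i <= N)%N -> tau i.+1 <= s + i.+1%:R * delta.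
  move=> iN; rewrite /tau; case: ifP => // /negbT; rewrite -ltnNge ltnS => Ni.
  by have -> : i = N by apply/eqP; rewrite eqn_leq iN.
have gridE i u : (i <= N)%N -> tau i <= u < tau i.+1 -> grid_floor delta u = tau i.
  move=> iN /andP[iu ui]; rewrite (tauE i iN).
  (* The starting time is itself a grid point, so the shifted grid is the one used by
     [grid_floor]. *)
  have e m : s + m%:R * delta = (j + m)%:R * delta by rewrite natrD mulrDl.
  rewrite e; apply: grid_floorE => //; rewrite -e -addnS -e -(tauE i iN) iu /=.
  exact: lt_le_trans (tau_le_next i iN).
have tau_ge i : s <= tau i.
  by elim: i => [|i IH]; [rewrite tau0|exact: le_trans (tau_leS i)].
have chain : {ae P, forall w, X (tau 0%N) w = x /\ forall i, (i <= N)%N -> X (tau i.+1) w =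
     X (tau i) w + (tau i.+1 - tau i) *: b (X (tau i) w) +
     (W (S (tau i.+1) w) w - W (S (tau i) w) w)}.
  apply: filterS EX => w Xw.
  (* The integrand is constant between consecutive grid points, so the drift integral is a finite
     sum; subtracting the equations at two consecutive times gives the recursion of the chain. *)
  have drift i : (i <= N.+1)%N -> \row_(l < d) \int[lebesgue_measure]_(u in `[s, tau i])
      (b (X (grid_floor delta u) w) ord0 l) =
      \sum_(m < i) (tau m.+1 - tau m) *: b (X (tau m) w).
    move=> iN; apply/rowP => l; rewrite mxE summxE -{1}tau0.
    have [_ ->] := @integral_piecewise R (fun u => b (X (grid_floor delta u) w) ord0 l) tau
      (fun m => b (X (tau m) w) ord0 l) N.+1 (fun i _ => tau_leS i)
      (fun m u mN mu => congr1 (fun r => b (X r w) ord0 l) (gridE m u mN mu)) i iN.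
    by apply: eq_bigr => m _; rewrite mxE.
  split=> [|i iN]; first by rewrite Xw// drift// big_ord0 addr0 tau0 subrr addr0.
  rewrite (Xw _ (tau_ge i.+1)) drift// big_ord_recr/=.
  set D := \sum_(m < i) _; set D' := _ *: _.
  rewrite (Xw _ (tau_ge i)) drift -/D; last exact: leqW.
  move: (W (S (tau i.+1) w) w) (W (S (tau i) w) w) (W (S s w) w) D D' => W1 W2 W0 D D'.
  by apply/rowP => l; rewrite !mxE; ring.
have tau00 : 0 <= tau 0%N by rewrite tau0.
have tauT : tau N.+1 - tau 0%N <= T by rewrite tauN1 tau0 lerBlDr (le_trans tT)// lerDl.
have mX i : measurable_fun setT (X (tau i)) by exact: measurable_funP.
have X0 : {ae P, forall w, X (tau 0%N) w = x} by apply: filterS chain => w [].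
have XS i : (i <= N)%N -> {ae P, forall w, X (tau i.+1) w =
     X (tau i) w + (tau i.+1 - tau i) *: b (X (tau i) w) +
     (W (S (tau i.+1) w) w - W (S (tau i) w) w)}.
  by move=> iN; apply: filterS chain => w [_ /(_ i iN)].
have [p [dp cp pC]] := HC N tau (fun i => X (tau i)) x tau00 tau_leS tau_lt tauT mX X0 XS.
exists p; split; first by split => //; rewrite tauN1 in dp.
have ts : 0 < t - s by rewrite subr_gt0.
move=> y; rewrite (p_alphaE hbeta hS Spos (y - x) ts (heta _ ts)).
by rewrite -EFinM lee_fin; rewrite tauN1 tau0 in pC.
Qed.
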